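(* Let $p\in\mathbb Z_{<0}$ and $r\in\mathbb C$. For each nonzero vector $x\in\mathcal F_{p,r}$, the cyclic $V^{\mathcal{SH}}(c_L,c_{L,\alpha})$-submodule $\langle x\rangle$ of $\mathcal F_{p,r}$ contains $v_{p,r}$. In particular, $L[p,r]\cong\langle v_{p,r}\rangle\subset\mathcal F_{p,r}$.
   Context: The $N=1$ Heisenberg-Virasoro algebra $\mathcal{SH}$ is the complex Lie superalgebra with even basis elements $L(n),\alpha(n)$ ($n\in\mathbb Z$), odd basis elements $G(n+\frac12),\Psi(n+\frac12)$ ($n\in\mathbb Z$), and even central elements $C_L,C_\alpha,C_{L,\alpha}$, with (super)commutators, for $m,n\in\mathbb Z$: $[\alpha(m),\alpha(n)]=\delta_{m+n,0}\,m\,C_\alpha$; $[L(m),\alpha(n)]=-n\,\alpha(m+n)-\delta_{m+n,0}(m^2+m)C_{L,\alpha}$; $[L(m),L(n)]=(m-n)L(m+n)+\delta_{m+n,0}\frac{m^3-m}{12}C_L$; $[\Psi(m+\frac12),\Psi(n+\frac12)]_+=\delta_{m+n+1,0}C_\alpha$; $[\alpha(m),\Psi(n+\frac12)]=0$; $[G(m+\frac12),G(n+\frac12)]_+=2L(m+n+1)+\delta_{m+n+1,0}\frac{m^2+m}{3}C_L$; $[L(m),G(n+\frac12)]=(\frac m2-n-\frac12)G(m+n+\frac12)$; $[\alpha(m),G(n+\frac12)]=m\,\Psi(m+n+\frac12)$; $[\Psi(m+\frac12),L(n)]=\frac{2m+n+1}{2}\Psi(m+n+\frac12)$; $[\Psi(m+\frac12),G(n+\frac12)]_+=\alpha(m+n+1)+2m\,\delta_{m+n+1,0}C_{L,\alpha}$.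 Let $\mathcal{SH}^{+}$ be the span of $L(n),\alpha(n),G(n-\frac12),\Psi(n-\frac12)$, $n\ge1$. Fix $c_L,c_{L,\alpha}\in\mathbb C$ with $c_{L,\alpha}\ne0$. For $h,h_\alpha\in\mathbb C$, $V(h,h_\alpha)$ denotes the Verma module: the universal $\mathcal{SH}$-module generated by a vector $v$ with $\mathcal{SH}^+v=0$, $L(0)v=hv$, $\alpha(0)v=h_\alpha v$, on which $C_L,C_\alpha,C_{L,\alpha}$ act by $c_L,0,c_{L,\alpha}$; $L(h,h_\alpha)$ is its simple quotient. For $p,r\in\mathbb C$ put $h_{p,r}=(1-p^2)\frac{c_L-3}{24}-rp$ and $L[p,r]=L(h_{p,r},(1+p)c_{L,\alpha})$. $V^{\mathcal{SH}}(c_L,c_{L,\alpha})=V(0,0)/\langle G(-\frac12)v\rangle$ is the associated universal vertex superalgebra; its submodules of the modules below are the same as $\mathcal{SH}$-submodules. Free field realisation: $M(1)$ is the rank two Heisenberg vertex algebra generated by $c(z),d(z)$ associated to the form $\langle c,c\rangle=\langle d,d\rangle=0$, $\langle c,d\rangle=2$. $F^{(2)}$ is the fermionic vertex superalgebra generated by odd fields $\Psi^\pm(z)=\sum_{n\in\mathbb Z}\Psi^\pm(n+\frac12)z^{-n-1}$ with $\{\Psi^\pm(r),\Psi^\pm(s)\}=0$, $\{\Psi^+(r),\Psi^-(s)\}=\delta_{r+s,0}$. Put $\omega_{fer}=\frac12(\Psi^+(-\frac32)\Psi^-(-\frac12)+\Psi^-(-\frac32)\Psi^+(-\frac12)){\bf1}$.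 In $M(1)\otimes F^{(2)}$ let (applied to the vacuum) $\alpha=-c_{L,\alpha}c(-1)$, $\Psi=-\sqrt2\,c_{L,\alpha}\Psi^-(-\frac12)$, $\tau=\sqrt2\left(\frac12c(-1)\Psi^+(-\frac12)+\frac12d(-1)\Psi^-(-\frac12)+\frac{c_L-3}{12}\Psi^-(-\frac32)-\Psi^+(-\frac32)\right)$, $\omega=\frac12c(-1)d(-1)+\frac{c_L-3}{24}c(-2)-\frac12d(-2)+\omega_{fer}$. The components of $Y(\alpha,z)=\sum\alpha(n)z^{-n-1}$, $Y(\Psi,z)=\sum\Psi(n+\frac12)z^{-n-1}$, $Y(\tau,z)=\sum G(n+\frac12)z^{-n-2}$, $Y(\omega,z)=\sum L(n)z^{-n-2}$ make every $M(1)\otimes F^{(2)}$-module into an $\mathcal{SH}$-module (and $V^{\mathcal{SH}}(c_L,c_{L,\alpha})$-module) with central charges $c_L,0,c_{L,\alpha}$. For $\gamma\in\mathbb C c+\mathbb C d$, $e^\gamma$ denotes the highest weight vector of the Heisenberg Fock module on which $c(0),d(0)$ act by $\langle c,\gamma\rangle,\langle d,\gamma\rangle$. Put $\overline d=d-\frac{c_L-3}{12}c$, $v_{p,r}=e^{-\frac{p+1}{2}\overline d+rc}$ (a highest weight vector of weight $(h_{p,r},(1+p)c_{L,\alpha})$) and $\mathcal F_{p,r}=(M(1)\otimes F^{(2)}).v_{p,r}$. *)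

(* Defs.v *)
From HB Require Import structures.
From mathcomp Require Import all_boot all_order all_algebra.
From mathcomp Require Import generic_quotient ring_quotient.
From mathcomp Require Import finmap multiset.
From mathcomp Require Import monalg.
From mathcomp Require Import complex.
From mathcomp Require Import boolp classical_sets fsbigop reals.

Set Implicit Arguments.
Unset Strict Implicit.
Unset Printing Implicit Defensive.

Import Order.TTheory GRing.Theory Num.Theory.
Local Open Scope classical_set_scope.
Local Open Scope ring_scope.
Local Open Scope quotient_scope.

(* A family of operators [act : X -> V -> V] is what a module over a Lie
   superalgebra with basis [X] amounts to, once the (super)commutators are
   imposed.  Submodules are not required to be homogeneous for the parity. *)
Section Modules.
Variables (C : nzRingType) (X : Type) (V : lmodType C) (act : X -> V -> V).

Definition submodule (N : set V) : Prop :=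
  [/\ N 0,
      forall a u v, N u -> N v -> N (a *: u + v) &
      forall x u, N u -> N (act x u)].

Definition submodule_gen (G : set V) : set V := smallest submodule G.

Definition cyclic_submodule (u : V) : set V := submodule_gen [set u].

Lemma submodule_genP (G : set V) : submodule (submodule_gen G).
Proof.
split=> [N [[]] //|a u v Gu Gv N NG|x u Gu N NG].
  by case: (NG.1) => _ clN _; apply: clN; [apply: Gu|apply: Gv].
by case: (NG.1) => _ _; apply; apply: Gu.
Qed.

Definition mem_gen (G : set V) : {pred V} := fun u => u \in submodule_gen G.

Lemma mem_gen_submod_closed (G : set V) : submod_closed (mem_gen G).
Proof.
have [G0 GD _] := submodule_genP G.
split=> [|a u v Gu Gv]; apply/mem_set => //.
by apply: GD; apply: set_mem.
Qed.

HB.instance Definition _ (G : set V) :=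
  GRing.isSubmodClosed.Build C V (mem_gen G) (mem_gen_submod_closed G).

Variable G : set V.

(* The quotient of [V] by the submodule generated by [G]. *)
Definition quo : Type := Quotient.quot (mem_gen G).
HB.instance Definition _ := GRing.Zmodule.on quo.

(* The class of [u], and a chosen representative of [q]. *)
Definition quo_pi (u : V) : quo := \pi_(Quotient.quot (mem_gen G)) u.
Definition quo_repr (q : quo) : V := repr q.

Lemma quo_reprK : cancel quo_repr quo_pi.
Proof. exact: reprK. Qed.

Lemma quo_piP (u v : V) : quo_pi u = quo_pi v <-> submodule_gen G (u - v).
Proof.
split=> [/eqP|uv]; first by rewrite -Quotient.idealrBE => /set_mem.
by apply/eqP; rewrite -Quotient.idealrBE; apply/mem_set.
Qed.

Lemma quo_piD (u v : V) : quo_pi (u + v) = quo_pi u + quo_pi v.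
Proof. exact: (raddfD (\pi_(Quotient.quot (mem_gen G)))). Qed.

Definition quo_scale (a : C) (q : quo) : quo := quo_pi (a *: quo_repr q).

Lemma quo_piZ (a : C) (u : V) : quo_pi (a *: u) = quo_scale a (quo_pi u).
Proof.
apply/quo_piP; rewrite -scalerBr -[_ *: _]addr0.
have [G0 GD _] := submodule_genP G; apply: (GD) => //.
by apply/quo_piP; rewrite quo_reprK.
Qed.

Lemma quo_scaleA a b q : quo_scale a (quo_scale b q) = quo_scale (a * b) q.
Proof.
by rewrite -[q]quo_reprK -(quo_piZ b) -(quo_piZ a) -(quo_piZ (a * b)) scalerA.
Qed.

Lemma quo_scale1 : left_id 1 quo_scale.
Proof. by move=> q; rewrite /quo_scale scale1r quo_reprK. Qed.

Lemma quo_scaleDr : right_distributive quo_scale +%R.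
Proof.
move=> a q s; rewrite -[q]quo_reprK -[s]quo_reprK -quo_piD.
by rewrite -!(quo_piZ a) scalerDr quo_piD.
Qed.

Lemma quo_scaleDl q : {morph quo_scale^~ q : a b / a + b}.
Proof. by move=> a b; rewrite /quo_scale scalerDl quo_piD. Qed.

HB.instance Definition _ := GRing.Zmodule_isLmodule.Build C quo
  quo_scaleA quo_scale1 quo_scaleDr quo_scaleDl.

Definition quo_act (x : X) (q : quo) : quo := quo_pi (act x (quo_repr q)).

Lemma quo_act_pi (x : X) (u : V) : linear (act x) ->
  quo_act x (quo_pi u) = quo_pi (act x u).
Proof.
move=> lin; apply/quo_piP; have [_ _ Gact] := submodule_genP G.
have -> : act x (quo_repr (quo_pi u)) - act x u
    = act x (quo_repr (quo_pi u) - u).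
  by rewrite addrC -scaleN1r -lin scaleN1r addrC.
by apply: Gact; apply/quo_piP; rewrite quo_reprK.
Qed.

End Modules.

Definition proper_submodules (C : nzRingType) (X : Type) (V : lmodType C)
    (act : X -> V -> V) : set (set V) :=
  [set N | submodule act N /\ N <> setT].

(* The quotient by the sum of all proper submodules: this is the simple
   quotient as soon as [V] has a largest proper submodule, which is the case
   for highest weight modules. *)
Definition simple_quo (C : nzRingType) (X : Type) (V : lmodType C)
    (act : X -> V -> V) : lmodType C :=
  quo act (\bigcup_(N in proper_submodules act) N).

Definition simple_quo_act (C : nzRingType) (X : Type) (V : lmodType C)
    (act : X -> V -> V) : X -> simple_quo act -> simple_quo act :=
  @quo_act C X V act (\bigcup_(N in proper_submodules act) N).

(* The module [U] is isomorphic to the submodule [N] of [V]. *)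
Definition isomorphic_to_submodule (C : nzRingType) (X : Type)
    (U V : lmodType C) (actU : X -> U -> U) (actV : X -> V -> V)
    (N : set V) : Prop :=
  exists f : {linear U -> V},
    [/\ injective f, forall x u, f (actU x u) = actV x (f u) & range f = N].

(* [gG n] and [gPsi n] stand for G(n + 1/2) and Psi(n + 1/2). *)
Variant gen : Type :=
  | gL of int | gAlpha of int | gG of int | gPsi of int | gCL | gCAlpha | gCLAlpha.
HB.instance Definition _ := gen_eqMixin gen.
HB.instance Definition _ := gen_choiceMixin gen.

Definition odd_gen (x : gen) : bool :=
  match x with gG _ | gPsi _ => true | _ => false end.

(* The subalgebra SH^+; note that G(n - 1/2) with n >= 1 is [gG (n - 1)]. *)
Definition positive_gen (x : gen) : bool :=
  match x with
  | gL n | gAlpha n => 1 <= n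
  | gG n | gPsi n => 0 <= n
  | _ => false
  end.

Section Algebra.
Variable C : numClosedFieldType.

Local Notation delta k := ((k == 0 :> int)%:R : C).

(* Linear combinations of basis elements are given by lists of terms. *)
Definition listed_bracket (x y : gen) : option (seq (C * gen)) :=
  match x, y with
  | gAlpha m, gAlpha n => Some [:: (delta (m + n) * m%:~R, gCAlpha)]
  | gL m, gAlpha n =>
      Some [:: (- n%:~R, gAlpha (m + n));
               (- (delta (m + n) * (m ^+ 2 + m)%:~R), gCLAlpha)]
  | gL m, gL n =>
      Some [:: ((m - n)%:~R, gL (m + n));
               (delta (m + n) * ((m ^+ 3 - m)%:~R / 12), gCL)]
  | gPsi m, gPsi n => Some [:: (delta (m + n + 1), gCAlpha)]
  | gAlpha m, gPsi n => Some [::]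
  | gG m, gG n =>
      Some [:: (2, gL (m + n + 1));
               (delta (m + n + 1) * ((m ^+ 2 + m)%:~R / 3), gCL)]
  | gL m, gG n => Some [:: (m%:~R / 2 - n%:~R - 1 / 2, gG (m + n))]
  | gAlpha m, gG n => Some [:: (m%:~R, gPsi (m + n))]
  | gPsi m, gL n => Some [:: ((2 * m + n + 1)%:~R / 2, gPsi (m + n))]
  | gPsi m, gG n =>
      Some [:: (1, gAlpha (m + n + 1));
               (2 * m%:~R * delta (m + n + 1), gCLAlpha)]
  | _, _ => None
  end.

Definition swap_sign (x y : gen) : C := (-1) ^+ (odd_gen x && odd_gen y).

(* The remaining brackets follow by super skew-symmetry or are central. *)
Definition sh_bracket (x y : gen) : seq (C * gen) :=
  match listed_bracket x y, listed_bracket y x with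
  | Some b, _ => b
  | None, Some b => [seq (- (swap_sign x y * t.1), t.2) | t <- b]
  | None, None => [::]
  end.

(* A word [:: x1; ...; xk] stands for the vector x1 ... xk v. *)
Definition words : lmodType C := {malg C[seq gen]}.
Definition word (w : seq gen) : words := << 1 *g w >>.

Definition lin_ext (K : choiceType) (V : lmodType C) (f : K -> V)
    (u : {malg C[K]}) : V :=
  \sum_(k <- msupp u) u@_k *: f k.

Definition word_act (x : gen) : words -> words :=
  lin_ext (fun w => word (x :: w)).

Section Verma.
Variables (cL cLA h hA : C).

Variant verma_relator : set words :=
  | Bracket_relator x y w : verma_relator
      (word [:: x, y & w] - swap_sign x y *: word [:: y, x & w]
        - \sum_(t <- sh_bracket x y) t.1 *: word (t.2 :: w))
  | Positive_relator x of positive_gen x : verma_relator (word [:: x])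
  | L0_relator : verma_relator (word [:: gL 0] - h *: word [::])
  | Alpha0_relator : verma_relator (word [:: gAlpha 0] - hA *: word [::])
  | CL_relator w : verma_relator (word (gCL :: w) - cL *: word w)
  | CAlpha_relator w : verma_relator (word (gCAlpha :: w) - 0 *: word w)
  | CLAlpha_relator w : verma_relator (word (gCLAlpha :: w) - cLA *: word w).

(* The Verma module V(h, hA) is presented by generators and relations. *)
Definition verma : lmodType C := quo word_act verma_relator.
Definition verma_act : gen -> verma -> verma :=
  @quo_act C gen words word_act verma_relator.

(* L(h, hA) *)
Definition irr : lmodType C := simple_quo verma_act.
Definition irr_act : gen -> irr -> irr := @simple_quo_act C gen verma verma_act.

End Verma.

(* The state (a, b, s, t) stands for the vector
     prod_(i in a) c(-i-1) prod_(i in b) d(-i-1)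
     prod_(i in s) Psi^+(-i-1/2) prod_(i in t) Psi^-(-i-1/2) e^gamma
   where the products over the sets s and t are ordered increasingly. *)
Definition state : choiceType :=
  ({mset nat}%mset * {mset nat}%mset * {fset nat} * {fset nat})%type.
Definition fock : lmodType C := {malg C[state]}.
Definition fock_vac : fock := << 1 *g (mset0, mset0, fset0, fset0) >>.

Definition below (s : {fset nat}) (i : nat) : nat :=
  #|` [fset j in s | (j < i)%N]%fset|.

(* A field a(z) = sum_n a_n z^(-n-1) is given by its modes [a n = a_n];
   thus the n-th mode of Psi^+(z) is Psi^+(n + 1/2).
   Recall that [Negz i] is - (i + 1). *)
Definition field := int -> fock -> fock.

(* On the Fock module of e^gamma, c(0) = <c, gamma> and d(0) = <d, gamma>;
   the commutators are [c(m), d(n)] = 2 m delta_(m+n,0). *)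
Definition c_field (c0 : C) : field := fun n =>
  lin_ext (fun k : state => let: (a, b, s, t) := k in
    match n with
    | Negz i => << 1 *g ((i +` a)%mset, b, s, t) >>
    | Posz 0 => << c0 *g k >>
    | Posz i.+1 => << (2 * i.+1 * b i)%:R *g (a, (b `\ i)%mset, s, t) >>
    end : fock).

Definition d_field (d0 : C) : field := fun n =>
  lin_ext (fun k : state => let: (a, b, s, t) := k in
    match n with
    | Negz i => << 1 *g (a, (i +` b)%mset, s, t) >>
    | Posz 0 => << d0 *g k >>
    | Posz i.+1 => << (2 * i.+1 * a i)%:R *g ((a `\ i)%mset, b, s, t) >>
    end : fock).

Definition psip_field : field := fun n =>
  lin_ext (fun k : state => let: (a, b, s, t) := k in
    match n with
    | Negz i => if i \in s then 0 else
        << (-1) ^+ below s i *g (a, b, (i |` s)%fset, t) >>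
    | Posz i => if i \in t then
        << (-1) ^+ (#|` s| + below t i) *g (a, b, s, (t `\ i)%fset) >> else 0
    end : fock).

Definition psim_field : field := fun n =>
  lin_ext (fun k : state => let: (a, b, s, t) := k in
    match n with
    | Negz i => if i \in t then 0 else
        << (-1) ^+ (#|` s| + below t i) *g (a, b, s, (i |` t)%fset) >>
    | Posz i => if i \in s then
        << (-1) ^+ below s i *g (a, b, (s `\ i)%fset, t) >> else 0
    end : fock).

(* The field of the state a_(-2) 1 when [a] is the field of a_(-1) 1. *)
Definition deriv_field (a : field) : field :=
  fun n u => - n%:~R *: a (n - 1) u.

(* The normally ordered product, i.e. the field of a_(-1) b; the flag [o] tells
   whether both fields are odd.  The sum has finite support whenever a_j u and
   b_j u vanish for j large enough. *)
Definition nop (o : bool) (a b : field) : field := fun n u =>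
  \sum_(j \in [set: nat])
    (a (- 1 - j%:Z) (b (n + j%:Z) u)
     + (-1) ^+ o *: b (n - 1 - j%:Z) (a j%:Z u)).

Definition heis : lmodType C := (C^o * C^o)%type.
Definition heis_c : heis := (1, 0).
Definition heis_d : heis := (0, 1).
Definition heis_form (x y : heis) : C := 2 * (x.1 * y.2 + x.2 * y.1).

Section FreeFieldRealisation.
Variables (cL cLA : C) (gamma : heis).

Let c := c_field (heis_form heis_c gamma).
Let d := d_field (heis_form heis_d gamma).
Let psip := psip_field.
Let psim := psim_field.

Definition alpha_field : field := fun n u => - cLA *: c n u.

Definition psi_field : field := fun n u => - (sqrtC 2 * cLA) *: psim n u.

Definition tau_field : field := fun n u =>
  sqrtC 2 *: (2^-1 *: nop false c psip n u
            + 2^-1 *: nop false d psim n u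
            + ((cL - 3) / 12) *: deriv_field psim n u
            - deriv_field psip n u).

Definition omega_fer_field : field := fun n u =>
  2^-1 *: (nop true (deriv_field psip) psim n u
         + nop true (deriv_field psim) psip n u).

Definition omega_field : field := fun n u =>
  2^-1 *: nop false c d n u
  + ((cL - 3) / 24) *: deriv_field c n u
  - 2^-1 *: deriv_field d n u
  + omega_fer_field n u.

Definition fock_act (x : gen) (u : fock) : fock :=
  match x with
  | gL n => omega_field (n + 1) u
  | gAlpha n => alpha_field n u
  | gG n => tau_field (n + 1) u
  | gPsi n => psi_field n u
  | gCL => cL *: u
  | gCAlpha => 0
  | gCLAlpha => cLA *: u
  end.

End FreeFieldRealisation.

Definition h_pr (cL p r : C) : C := (1 - p ^+ 2) * ((cL - 3) / 24) - r * p.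

Definition irr_pr (cL cLA p r : C) : lmodType C :=
  irr cL cLA (h_pr cL p r) ((1 + p) * cLA).
Definition irr_pr_act (cL cLA p r : C) : gen -> irr_pr cL cLA p r -> irr_pr cL cLA p r :=
  @irr_act cL cLA (h_pr cL p r) ((1 + p) * cLA).

(* v_(p,r) = e^(gamma_pr p r) is [fock_vac] in F_(p,r), whose underlying vector
   space [fock] does not depend on (p, r): only [F_pr_act] does. *)
Definition gamma_pr (cL p r : C) : heis :=
  - ((p + 1) / 2) *: (heis_d - ((cL - 3) / 12) *: heis_c) + r *: heis_c.

Definition F_pr_act (cL cLA p r : C) : gen -> fock -> fock :=
  fock_act cL cLA (gamma_pr cL p r).

End Algebra.

(* Main.v *)
Require Import Defs.
From HB Require Import structures.
From mathcomp Require Import all_boot all_order all_algebra.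
From mathcomp Require Import finmap multiset.
From mathcomp Require Import monalg.
From mathcomp Require Import complex.
From mathcomp Require Import boolp classical_sets fsbigop reals.
From mathcomp Require Import zify ring.

(** The proof has two halves.

    Every nonzero submodule contains v.  For n >= 1 the mode alpha(n) is a
    nonzero multiple of c(n), and for n >= 0 the mode Psi(n + 1/2) is a nonzero
    multiple of Psi^-(n + 1/2).  On a vector killed by all of these, where c(0)
    acts by -(p + 1), the mode L(n) acts as (n - p)/2 times d(n) plus terms that
    involve modes of d and Psi^+ of higher index, and G(n + 1/2) acts as
    sqrt 2 (n + (1 - p)/2) Psi^+(n + 1/2) plus such terms.  Since p < 0, these
    coefficients never vanish in the range n >= 1, respectively n >= 0.
    Descending induction on the index ([singular_annihilated]) therefore shows
    that a vector killed by all positive generators is killed by all the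
    annihilation operators of the free fields, so that it is a multiple of v.
    As the positive generators lower the conformal weight, applying them to a
    nonzero vector as long as the result is not zero ends in such a multiple
    ([submodule_vac]).

    The submodule generated by v is L[p,r].  The relations of the superalgebra
    have to be checked on the Fock space ([fock_brackets]).  The commutators of
    L and G with the free fields all come from one contraction formula for
    normally ordered products ([nop_comm]).  The failure of a relation between
    L and G then supercommutes with the free fields, and such an operator is
    zero as soon as it kills the vacuum ([schur]).  For reasons of weight this
    only remains to be computed for the anticommutator of G(m + 1/2) and
    G(-m - 1/2) ([tau_tau_vac]), and the commutators of the Virasoro modes
    follow from the other ones.  The Fock space being a module, the Verma module
    maps to it with image the submodule generated by v.  A submodule N of the
    Verma module that is not contained in the kernel has an element mapped to
    v, by the first half; products of operators L(0) - h - k with k <> 0 turn it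
    into a nonzero multiple of the highest weight vector ([weight_projection]),
    so that N is the whole Verma module.  Thus the kernel is the largest proper
    submodule ([proper_sub_kernel]), which gives the isomorphism
    ([irr_iso_cyclic]). *)

Set Implicit Arguments.
Unset Strict Implicit.
Unset Printing Implicit Defensive.

Import Order.TTheory GRing.Theory Num.Theory.
Local Open Scope classical_set_scope.
Local Open Scope ring_scope.

(** * Linear functions and linear extensions *)

Section LinearFunctions.
Variables (C : nzRingType) (U V : lmodType C) (f : U -> V).
Hypothesis f_lin : linear f.

Lemma lin0 : f 0 = 0.
Proof. by have := f_lin (-1) 0 0; rewrite scaler0 addr0 scaleN1r addNr. Qed.

Lemma linD u v : f (u + v) = f u + f v.
Proof. by rewrite -[u]scale1r f_lin !scale1r. Qed.

Lemma linZ a u : f (a *: u) = a *: f u.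
Proof. by rewrite -[_ *: _]addr0 f_lin lin0 addr0. Qed.

Lemma linN u : f (- u) = - f u.
Proof. by rewrite -scaleN1r linZ scaleN1r. Qed.

Lemma linB u v : f (u - v) = f u - f v.
Proof. by rewrite linD linN. Qed.

Lemma lin_sum I (r : seq I) (P : pred I) (F : I -> U) :
  f (\sum_(i <- r | P i) F i) = \sum_(i <- r | P i) f (F i).
Proof. exact: (big_morph f linD lin0). Qed.

End LinearFunctions.

Section LinExt.
Variables (C : numClosedFieldType) (K : choiceType) (V : lmodType C).
Implicit Types (f : K -> V) (u : {malg C[K]}).

Lemma lin_extEw f u (d : {fset K}) : (msupp u `<=` d)%fset ->
  lin_ext f u = \sum_(k <- d) u@_k *: f k.
Proof.
move=> ud; rewrite /lin_ext; apply: big_fset_incl => // k _ /mcoeff_outdom ->.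
by rewrite scale0r.
Qed.

Lemma lin_ext_linear f : linear (lin_ext f).
Proof.
move=> a u v; pose d := (msupp u `|` msupp v)%fset.
have ud : (msupp u `<=` d)%fset by apply: fsubsetUl.
have vd : (msupp v `<=` d)%fset by apply: fsubsetUr.
have uvd : (msupp (a *: u + v) `<=` d)%fset.
  apply: fsubset_trans (msuppD_le _ _) _; apply: fsetSU; exact: msuppZ_le.
rewrite (lin_extEw f ud) (lin_extEw f vd) (lin_extEw f uvd) scaler_sumr.
rewrite -big_split /=; apply: eq_bigr => k _.
by rewrite mcoeffD mcoeffZ scalerDl scalerA.
Qed.

Lemma lin_extU f a k : lin_ext f << a *g k >> = a *: f k.
Proof. by rewrite (lin_extEw f msuppU_le) big_seq_fset1 mcoeffUU. Qed.

Lemma malgZU a b (k : K) : a *: << b *g k >> = << a * b *g k >> :> {malg C[K]}.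
Proof. by apply/malgP => k'; rewrite mcoeffZ !mcoeffU mulrnAr. Qed.

Lemma malg_ind (P : {malg C[K]} -> Prop) :
  P 0 -> (forall a u v, P u -> P v -> P (a *: u + v)) ->
  (forall k, P << 1 *g k >>) -> forall u, P u.
Proof.
move=> P0 PD PU u; rewrite [u]monalgE; elim/big_ind: _ => //.
  by move=> v w Pv Pw; rewrite -[v]scale1r; apply: PD.
move=> k _; rewrite -[_@_k]mulr1 -malgZU -[_ *: _]addr0; exact: PD.
Qed.

End LinExt.

(** The reason why an annihilation operator detects every state that it does not
    kill. *)
Lemma mcoeff_lin_ext (C : numClosedFieldType) (K L : choiceType)
    (f : K -> {malg C[L]}) (u : {malg C[K]}) k l :
  (forall k', k' != k -> (f k')@_l = 0) -> (lin_ext f u)@_l = u@_k * (f k)@_l.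
Proof.
move=> fl; pose d := (k |` msupp u)%fset.
have ud : (msupp u `<=` d)%fset by apply: fsubsetUr.
rewrite (lin_extEw f ud) raddf_sum /= (big_fsetD1 k) /=; last by rewrite !inE eqxx.
rewrite mcoeffZ big_seq big1 ?addr0 // => k'; rewrite !inE => /andP[kk' _].
by rewrite mcoeffZ fl ?mulr0.
Qed.

(** * The fermionic operators *)

Section FermionSigns.
Implicit Types (s : {fset nat}) (k : state) (x y : bool * nat).

Definition toggle s (i : nat) : {fset nat} :=
  if i \in s then (s `\ i)%fset else (i |` s)%fset.

Lemma in_toggle s i j : (j \in toggle s i) = (j \in s) (+) (i == j).
Proof.
rewrite /toggle; case: ifPn => si; rewrite !inE [i == j]eq_sym;
  by case: eqVneq => [->|_] //=; rewrite ?si ?(negbTE si) ?addbF.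
Qed.

Lemma toggleK s i : toggle (toggle s i) i = s.
Proof. by apply/fsetP => j; rewrite !in_toggle -addbA addbb addbF. Qed.

Lemma toggleC s i j : toggle (toggle s i) j = toggle (toggle s j) i.
Proof. by apply/fsetP => l; rewrite !in_toggle -!addbA [(i == l) (+) _]addbC. Qed.

Lemma odd_card_toggle s i : odd #|` toggle s i| = ~~ odd #|` s|.
Proof.
rewrite /toggle; case: ifPn => si; last by rewrite cardfsU1 si.
by rewrite [in RHS](cardfsD1 i) si negbK.
Qed.

Lemma odd_below_toggle s i j :
  odd (below (toggle s i) j) = odd (below s j) (+) (i < j)%N.
Proof.
rewrite /below; have [ij|ji] := ltnP i j; last first.
  rewrite addbF; congr (odd #|` _|); apply/fsetP => l; rewrite !inE in_toggle.
  by case: eqVneq => [<-|_]; rewrite ?addbF // ltnNge ji !andbF.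
rewrite addbT -(odd_card_toggle _ i); congr (odd #|` _|).
apply/fsetP => l; rewrite in_toggle !inE in_toggle.
by case: eqVneq => [<-|_]; rewrite ?addbF // ij !andbT.
Qed.

(** The pair [(true, i)] stands for Psi^+(-i-1/2) and [(false, i)] for
    Psi^-(-i-1/2); ordering the former before the latter makes both families
    instances of one pattern of fermionic signs. *)
Definition occupied x k : bool := if x.1 then x.2 \in k.1.2 else x.2 \in k.2.

Definition toggle_state x k : state :=
  let: (a, b, s, t) := k in
  if x.1 then (a, b, toggle s x.2, t) else (a, b, s, toggle t x.2).

Definition passed x k : nat :=
  let: (a, b, s, t) := k in
  if x.1 then below s x.2 else (#|` s| + below t x.2)%N.

Definition precedes x y : bool :=
  if x.1 == y.1 then (x.2 < y.2)%N else x.1.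

Lemma precedes_antisym x y : x != y -> precedes y x = ~~ precedes x y.
Proof.
case: x y => [f i] [g j]; rewrite /precedes /= xpair_eqE.
rewrite [g == f]eq_sym; case: eqVneq => [_ /= ij|]; last by case: f g => [] [].
by rewrite -leqNgt ltn_neqAle eq_sym ij.
Qed.

Lemma precedes_irrefl x : precedes x x = false.
Proof. by rewrite /precedes eqxx ltnn. Qed.

Lemma occupied_toggle x y k :
  occupied x (toggle_state y k) = occupied x k (+) (x == y).
Proof.
case: k x y => [[[a b] s] t] [f i] [g j]; rewrite xpair_eqE.
by case: f g => [] []; rewrite /occupied /= ?in_toggle ?addbF // [j == i]eq_sym.
Qed.

Lemma toggle_stateK x k : toggle_state x (toggle_state x k) = k.
Proof. by case: k x => [[[a b] s] t] [[] i] /=; rewrite toggleK. Qed.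

Lemma toggle_stateC x y k :
  toggle_state x (toggle_state y k) = toggle_state y (toggle_state x k).
Proof. by case: k x y => [[[a b] s] t] [[] i] [[] j] //=; rewrite toggleC. Qed.

Lemma odd_passed_toggle x y k :
  odd (passed x (toggle_state y k)) = odd (passed x k) (+) precedes y x.
Proof.
case: k x y => [[[a b] s] t] [[] i] [[] j]; rewrite /precedes /=.
- by rewrite odd_below_toggle.
- by rewrite addbF.
- by rewrite !oddD odd_card_toggle addNb addbT.
- by rewrite !oddD odd_below_toggle addbA.
Qed.

End FermionSigns.

Section Fermions.
Variable C : numClosedFieldType.
Implicit Types (x y : bool * nat) (b : bool) (u : fock C).

(** Creates ([b = false]) or annihilates ([b = true]) the fermion [x]. *)
Definition fermion x b : fock C -> fock C :=
  lin_ext (fun k : state =>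
    if occupied x k == b then << (-1) ^+ passed x k *g toggle_state x k >>
    else 0 : fock C).

Lemma fermionU x b k : fermion x b << 1 *g k >> =
  if occupied x k == b then << (-1) ^+ passed x k *g toggle_state x k >> else 0.
Proof. by rewrite /fermion lin_extU scale1r. Qed.

Lemma fermion_linear x b : linear (fermion x b).
Proof. exact: lin_ext_linear. Qed.

Lemma fermion_pair x y b b' k :
  fermion x b (fermion y b' << 1 *g k >>) =
  if (occupied y k == b') && (occupied x k (+) (x == y) == b)
  then << (-1) ^+ (passed x k + passed y k + precedes y x)
        *g toggle_state x (toggle_state y k) >> else 0.
Proof.
rewrite fermionU; case: ifP => _ /=; last by rewrite lin0 //; apply: fermion_linear.
rewrite -[_ ^+ _]mulr1 -malgZU linZ; last exact: fermion_linear.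
rewrite fermionU occupied_toggle; case: ifP => _; rewrite ?scaler0 //.
rewrite malgZU -exprD; congr << _ *g _ >>.
rewrite -[LHS]signr_odd -[RHS]signr_odd !oddD odd_passed_toggle oddb.
by rewrite addbA [odd (passed y k) (+) _]addbC.
Qed.

(** The canonical anticommutation relations: toggling [x] before [y] or after
    it changes the sign through [precedes] unless [x = y], and then exactly one
    of the two products survives on each basis state. *)
Lemma fermion_anticomm x y b b' u :
  fermion x b (fermion y b' u) + fermion y b' (fermion x b u)
  = ((x == y) && (b != b'))%:R *: u.
Proof.
elim/malg_ind: u => [|a u v IHu IHv|k].
- by rewrite !(lin0 (@fermion_linear _ _)) scaler0 addr0.
- rewrite !fermion_linear scalerDr scalerA mulrC -scalerA -IHu -IHv.
  by rewrite scalerDr addrACA.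
rewrite !fermion_pair [y == x]eq_sym; case: (eqVneq x y) => [<-|xy] /=.
  rewrite precedes_irrefl addn0 addnn -signr_odd odd_double toggle_stateK.
  case: (occupied x k); case: b; case: b'; 
    by rewrite /= ?addr0 ?add0r ?scale0r ?scale1r ?expr0.
rewrite !addbF scale0r [X in _ + (if X then _ else _)]andbC.
case: (_ && _); last by rewrite addr0.
rewrite (precedes_antisym xy) toggle_stateC [(passed y k + passed x k)%N]addnC.
apply/malgP => l; rewrite mcoeffD !mcoeffU mcoeff0 -mulrnDl !exprD.
by case: (precedes x y); rewrite expr0 expr1 mulr1 mulrN1 ?addrN ?addNr mul0rn.
Qed.

Lemma psipE n u : psip_field n u =
  match n with Negz i => fermion (true, i) false u
             | Posz i => fermion (false, i) true u end.
Proof.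
case: n => i; congr (lin_ext _ u); apply/funext => -[[[a b] s] t];
  by rewrite /occupied /= /toggle; case: (i \in _).
Qed.

Lemma psimE n u : psim_field n u =
  match n with Negz i => fermion (false, i) false u
             | Posz i => fermion (true, i) true u end.
Proof.
case: n => i; congr (lin_ext _ u); apply/funext => -[[[a b] s] t];
  by rewrite /occupied /= /toggle; case: (i \in _).
Qed.

Lemma psip_linear n : linear (@psip_field C n).
Proof. by case: n => i a u v; rewrite !psipE fermion_linear. Qed.

Lemma psim_linear n : linear (@psim_field C n).
Proof. by case: n => i a u v; rewrite !psimE fermion_linear. Qed.

Lemma psipp m n u :
  psip_field m (psip_field n u) = - psip_field n (psip_field m u).
Proof.
by apply/eqP; rewrite -addr_eq0 !psipE; case: m n => i [] j;
  rewrite fermion_anticomm /= ?andbF scale0r.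
Qed.

Lemma psimm m n u :
  psim_field m (psim_field n u) = - psim_field n (psim_field m u).
Proof.
by apply/eqP; rewrite -addr_eq0 !psimE; case: m n => i [] j;
  rewrite fermion_anticomm /= ?andbF scale0r.
Qed.

Lemma psipm m n u :
  psip_field m (psim_field n u) =
  - psim_field n (psip_field m u) + (m + n + 1 == 0 :> int)%:R *: u.
Proof.
apply/eqP; rewrite addrC -subr_eq opprK !psipE !psimE; apply/eqP.
case: m n => i [] j; rewrite fermion_anticomm /= ?andbF ?andbT; congr (_%:R *: _).
all: by rewrite ?xpair_eqE /=; do ?case: eqP => //; lia.
Qed.

Lemma psimp m n u :
  psim_field m (psip_field n u) =
  - psip_field n (psim_field m u) + (m + n + 1 == 0 :> int)%:R *: u.
Proof. by rewrite psipm opprD opprK [n + m]addrC addrNK. Qed.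

End Fermions.

(** * The bosonic operators *)

Section BosonStates.
Implicit Types (f g : bool) (i j : nat) (k : state).
Local Open Scope mset_scope.

(** The flag [true] refers to the modes of c and [false] to those of d. *)
Definition mult f i k : nat := let: (a, b, s, t) := k in if f then a i else b i.

Definition add_boson f i k : state := let: (a, b, s, t) := k in
  if f then (i +` a, b, s, t) else (a, i +` b, s, t).

Definition del_boson f i k : state := let: (a, b, s, t) := k in
  if f then (a `\ i, b, s, t) else (a, b `\ i, s, t).

Lemma mult_add f i g j k :
  mult f i (add_boson g j k) = (((f, i) == (g, j)) + mult f i k)%N.
Proof. by case: k f g => [[[a b] s] t] [] []; rewrite xpair_eqE /= ?mset1DE. Qed.

Lemma mult_del f i g j k :
  mult f i (del_boson g j k) = (mult f i k - ((f, i) == (g, j)))%N.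
Proof.
by case: k f g => [[[a b] s] t] [] []; rewrite xpair_eqE /= ?msetB1E ?subn0.
Qed.

Lemma add_bosonC f i g j k :
  add_boson f i (add_boson g j k) = add_boson g j (add_boson f i k).
Proof. by case: k f g => [[[a b] s] t] [] [] //=; rewrite msetDCA. Qed.

Lemma msetB1C (a : {mset nat}) i j : a `\ i `\ j = a `\ j `\ i.
Proof. by apply/msetP => l; rewrite !msetB1E subnAC. Qed.

Lemma del_bosonC f i g j k :
  del_boson f i (del_boson g j k) = del_boson g j (del_boson f i k).
Proof. by case: k f g => [[[a b] s] t] [] [] //=; rewrite msetB1C. Qed.

Lemma add_bosonK f i k : del_boson f i (add_boson f i k) = k.
Proof. by case: k f => [[[a b] s] t] [] /=; rewrite msetD1K. Qed.

Lemma del_bosonK f i k : (0 < mult f i k)%N -> add_boson f i (del_boson f i k) = k.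
Proof. by case: k f => [[[a b] s] t] [] /=; rewrite mset_gt0 => ai; rewrite msetB1K. Qed.

Lemma del_add_boson f i g j k : (f, i) != (g, j) ->
  del_boson f i (add_boson g j k) = add_boson g j (del_boson f i k).
Proof.
have neqE (a : {mset nat}) : i != j -> (j +` a) `\ i = j +` (a `\ i).
  move=> ij; apply/msetP => l; rewrite !(msetB1E, mset1DE).
  by have [->|_] := eqVneq l i; rewrite ?(negbTE ij) // !subn0.
by case: k f g => [[[a b] s] t] [] []; rewrite xpair_eqE //= => ij; rewrite neqE.
Qed.

Lemma toggle_add x f i k :
  toggle_state x (add_boson f i k) = add_boson f i (toggle_state x k).
Proof. by case: k x f => [[[a b] s] t] [[] l] []. Qed.

Lemma toggle_del x f i k :
  toggle_state x (del_boson f i k) = del_boson f i (toggle_state x k).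
Proof. by case: k x f => [[[a b] s] t] [[] l] []. Qed.

Lemma mult_toggle x f i k : mult f i (toggle_state x k) = mult f i k.
Proof. by case: k x => [[[a b] s] t] [[] l]. Qed.

Lemma occupied_add x f i k : occupied x (add_boson f i k) = occupied x k.
Proof. by case: k f => [[[a b] s] t] []. Qed.

Lemma occupied_del x f i k : occupied x (del_boson f i k) = occupied x k.
Proof. by case: k f => [[[a b] s] t] []. Qed.

Lemma passed_add x f i k : passed x (add_boson f i k) = passed x k.
Proof. by case: k f => [[[a b] s] t] []. Qed.

Lemma passed_del x f i k : passed x (del_boson f i k) = passed x k.
Proof. by case: k f => [[[a b] s] t] []. Qed.

End BosonStates.

Section Bosons.
Variable C : numClosedFieldType.
Implicit Types (f g : bool) (z w : C) (m n : int) (u : fock C) (k : state).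

(** As [<c, d> = 2], the positive modes of c differentiate along those of d
    and conversely. *)
Definition boson_on f z n k : fock C :=
  match n with
  | Negz i => << 1 *g add_boson f i k >>
  | Posz 0 => << z *g k >>
  | Posz i.+1 => << (2 * i.+1 * mult (~~ f) i k)%:R *g del_boson (~~ f) i k >>
  end.

Definition boson f z n : fock C -> fock C := lin_ext (boson_on f z n).

Lemma boson_linear f z n : linear (boson f z n).
Proof. exact: lin_ext_linear. Qed.

Lemma bosonU f z n a k : boson f z n << a *g k >> = a *: boson_on f z n k.
Proof. exact: lin_extU. Qed.

Lemma boson0E f z a k : boson f z 0 << a *g k >> = << a * z *g k >>.
Proof. by rewrite bosonU malgZU. Qed.

Lemma boson_addE f z i a k :
  boson f z (Negz i) << a *g k >> = << a *g add_boson f i k >>.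
Proof. by rewrite bosonU malgZU mulr1. Qed.

Lemma boson_delE f z i a k : boson f z i.+1 << a *g k >> =
  << a * (2 * i.+1 * mult (~~ f) i k)%:R *g del_boson (~~ f) i k >>.
Proof. by rewrite bosonU malgZU. Qed.

Let bosonE := (boson0E, boson_addE, boson_delE).

Lemma boson_pair f z i g w j k :
  boson f z (Posz i) (boson g w (Negz j) << 1 *g k >>)
  - boson g w (Negz j) (boson f z (Posz i) << 1 *g k >>)
  = ((f != g) && (i == j.+1))%:R * (2 * i%:R) *: << 1 *g k >>.
Proof.
case: i => [|i]; rewrite !bosonE; first by rewrite mul1r subrr andbF mul0r scale0r.
rewrite mult_add !mul1r eqSS.
have fgE : (f != g) && (i == j) = ((~~ f, i) == (g, j)).
  by rewrite xpair_eqE; case: f g => [] [].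
rewrite fgE; case: (eqVneq (~~ f, i) (g, j)) => [[<- <-]|neq].
  rewrite add_bosonK malgZU !mulr1 mul1r -natrM.
  case: (posnP (mult (~~ f) i k)) => [->|pos].
    by rewrite muln0 addn0 muln1 monalgU0 subr0.
  by rewrite del_bosonK // -monalgUB -natrB ?leq_mul2l ?leq_addl // -mulnBr addnK muln1.
by rewrite del_add_boson // add0n subrr mul0r scale0r.
Qed.

Lemma boson_comm f z m g w n u :
  boson f z m (boson g w n u) = boson g w n (boson f z m u)
    + ((f != g) && (m + n == 0))%:R * (2 * m%:~R) *: u.
Proof.
elim/malg_ind: u => [|a u v IHu IHv|k].
- by rewrite !(lin0 (@boson_linear _ _ _)) scaler0 addr0.
- rewrite !boson_linear IHu IHv !scalerDr !scalerA [_ * a]mulrC -!addrA.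
  by congr (_ + _); rewrite addrCA.
case: m n => [[|m]|m] [[|n]|n].
- rewrite mulr0z !mulr0 scale0r addr0 !bosonE.
  by congr << _ *g _ >>; ring.
- rewrite (_ : (_ + _ == 0) = false) ?andbF ?mul0r ?scale0r ?addr0; last by lia.
  rewrite !bosonE.
  by congr << _ *g _ >>; ring.
- rewrite (_ : (_ + _ == 0) = false) ?andbF ?mul0r ?scale0r ?addr0; last by lia.
  rewrite !bosonE.
  by congr << _ *g _ >>; ring.
- rewrite (_ : (_ + _ == 0) = false) ?andbF ?mul0r ?scale0r ?addr0; last by lia.
  rewrite !bosonE.
  by congr << _ *g _ >>; ring.
- rewrite (_ : (_ + _ == 0) = false) ?andbF ?mul0r ?scale0r ?addr0; last by lia.
  rewrite !bosonE.
  rewrite !mult_del del_bosonC; congr << _ *g _ >>.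
  rewrite ?mulr1 ?mul1r -!natrM; congr _%:R.
  rewrite [(~~ g, n) == _]eq_sym; case: eqVneq => [[<- <-]|_]; last by rewrite !subn0; lia.
  by rewrite mulnC.
- have /eqP := boson_pair f z m.+1 g w n k; rewrite subr_eq => /eqP ->.
  have -> : (m.+1%:Z + Negz n == 0) = (m.+1 == n.+1) by lia.
  by rewrite addrC.
- rewrite (_ : (_ + _ == 0) = false) ?andbF ?mul0r ?scale0r ?addr0; last by lia.
  rewrite !bosonE.
  by congr << _ *g _ >>; ring.
- have /eqP := boson_pair g w n.+1 f z m k; rewrite subr_eq => /eqP ->.
  rewrite addrAC -scalerDl [g == f]eq_sym [n.+1 == _]eq_sym.
  have -> : (Negz m + n.+1%:Z == 0) = (m.+1 == n.+1) by lia.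
  case: (eqVneq m n) => [->|neq]; rewrite ?eqSS ?eqxx ?(negbTE neq) ?andbF
    ?mul0r ?addr0 ?scale0r ?add0r //.
  by rewrite NegzE mulrNz !mulrN addrN scale0r add0r.
- rewrite (_ : (_ + _ == 0) = false) ?andbF ?mul0r ?scale0r ?addr0; last by lia.
  by rewrite !bosonE add_bosonC.
Qed.

(** Bosons and fermions act on different tensor factors. *)
Lemma boson_fermion f z n x b u :
  boson f z n (fermion x b u) = fermion x b (boson f z n u).
Proof.
elim/malg_ind: u => [|a u v IHu IHv|k].
- by rewrite (lin0 (@boson_linear _ _ _)) (lin0 (@fermion_linear _ _ _))
    (lin0 (@boson_linear _ _ _)).
- by rewrite !boson_linear !fermion_linear !boson_linear IHu IHv.
rewrite fermionU bosonU scale1r.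
have fermionUa a k' : fermion x b << a *g k' >> =
    if occupied x k' == b then << a * (-1) ^+ passed x k' *g toggle_state x k' >>
    else 0 :> fock C.
  rewrite -[a]mulr1 -malgZU (linZ (@fermion_linear _ _ _)) fermionU.
  by case: (_ == b); rewrite ?scaler0 // malgZU mulr1.
have -> : fermion x b (boson_on f z n k) = if occupied x k == b then
    (-1) ^+ passed x k *: boson_on f z n (toggle_state x k) else 0.
  case: n => [[|i]|i]; rewrite /boson_on fermionUa ?occupied_add ?occupied_del
     ?passed_add ?passed_del ?toggle_add ?toggle_del ?mult_toggle;
  by case: (_ == b); rewrite // malgZU mulrC.
by case: (_ == b); rewrite ?bosonU // (lin0 (@boson_linear _ _ _)).
Qed.

Lemma c_fieldE z n u : c_field z n u = boson true z n u.
Proof.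
by congr (lin_ext _ u); apply/funext => -[[[a b] s] t]; case: n => [[|i]|i].
Qed.

Lemma d_fieldE z n u : d_field z n u = boson false z n u.
Proof.
by congr (lin_ext _ u); apply/funext => -[[[a b] s] t]; case: n => [[|i]|i].
Qed.

End Bosons.

(** * The conformal weight *)

Section Weight.
Implicit Types (f : bool) (x : bool * nat) (k : state).

(** Twice the conformal weight above the highest weight vector, so that it
    takes integer values on fermions too. *)
Definition weight k : nat := let: (a, b, s, t) := k in
  (\sum_(i <- (a : {mset nat}%mset)) 2 * i.+1 + \sum_(i <- (b : {mset nat}%mset)) 2 * i.+1
   + \sum_(i <- (s : {fset nat})) i.*2.+1
   + \sum_(i <- (t : {fset nat})) i.*2.+1)%N.

Definition vac : state := (mset0, mset0, fset0, fset0).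

Lemma sum_mset_add (a : {mset nat}%mset) i (F : nat -> nat) :
  (\sum_(j <- (i +` a)%mset) F j = F i + \sum_(j <- a) F j)%N.
Proof.
rewrite -(big_cons _ _ i a xpredT F); apply: perm_big; apply/allP => x _ /=.
by rewrite !count_mem_mset mset1DE [x == i]eq_sym.
Qed.

Lemma sum_toggle (s : {fset nat}) i (F : nat -> nat) : i \in s ->
  (\sum_(j <- s) F j = F i + \sum_(j <- toggle s i) F j)%N.
Proof. by move=> si; rewrite (big_fsetD1 i) //= /toggle si. Qed.

Lemma weight_add f i k : weight (add_boson f i k) = (weight k + 2 * i.+1)%N.
Proof. by case: k f => [[[a b] s] t] [] /=; rewrite sum_mset_add /=; lia. Qed.

Lemma weight_del f i k : (0 < mult f i k)%N ->
  weight k = (weight (del_boson f i k) + 2 * i.+1)%N.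
Proof. by move=> ki; rewrite -(weight_add f) del_bosonK. Qed.

Lemma weight_toggle x k : occupied x k ->
  weight k = (weight (toggle_state x k) + x.2.*2.+1)%N.
Proof.
case: k x => [[[a b] s] t] [[] i] => si /=;
  by rewrite (sum_toggle (fun j => j.*2.+1) si) /=; lia.
Qed.

Lemma state_cases k : [\/ k = vac, exists f i, (0 < mult f i k)%N
  | exists x, occupied x k].
Proof.
case: k => [[[a b] s] t].
have [->|[i ai]] := mset_0Vmem a; last first.
  by apply: Or32; exists true, i; rewrite /= mset_gt0.
have [->|[i ai]] := mset_0Vmem b; last first.
  by apply: Or32; exists false, i; rewrite /= mset_gt0.
have [->|[i ai]] := fset_0Vmem s; last by apply: Or33; exists (true, i).
have [->|[i ai]] := fset_0Vmem t; last by apply: Or33; exists (false, i).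
exact: Or31.
Qed.

End Weight.

Section FockSpace.
Variable C : numClosedFieldType.
Implicit Types (u v : fock C) (k l : state) (P : fock C -> Prop).

(** The Fock space is generated from the vacuum by the creation operators. *)
Lemma fock_ind (z : bool -> C) P : P (fock_vac C) ->
  (forall a u v, P u -> P v -> P (a *: u + v)) ->
  (forall f i u, P u -> P (boson f (z f) (Negz i) u)) ->
  (forall x u, P u -> P (fermion x false u)) ->
  forall u, P u.
Proof.
move=> Pvac PD Pb Pf.
have P0 : P 0 by have := PD (-1) _ _ Pvac Pvac; rewrite scaleN1r addNr.
apply: malg_ind => [||k]; [exact: P0|exact: PD|].
have [n] := ubnP (weight k); elim: n k => [k kn|n IHn k kn].
  by exfalso; rewrite ltn0 in kn.
case: (state_cases k) => [->|[f [i ki]]|[x kx]]; first exact: Pvac.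
  have -> : << 1 *g k >> = boson f (z f) (Negz i) << 1 *g del_boson f i k >>.
    by rewrite boson_addE del_bosonK.
  by apply: Pb; apply: IHn; have := weight_del ki; lia.
have -> : << 1 *g k >> = (-1 : C) ^+ passed x (toggle_state x k) *:
    fermion x false << 1 *g toggle_state x k >>.
  rewrite fermionU occupied_toggle eqxx addbT kx toggle_stateK malgZU -exprD addnn.
  by rewrite -signr_odd odd_double.
rewrite -[_ *: _]addr0; apply: PD; last exact: P0.
apply: Pf; apply: IHn.
by have := weight_toggle kx; lia.
Qed.

(** Only the multiples of the vacuum are annihilated by every annihilation
    operator: a state other than the vacuum contains some excitation, and the
    operator removing it is injective on the states that contain it. *)
Lemma annihilated_vac (z : bool -> C) u :
  (forall f i, boson f (z f) (Posz i.+1) u = 0) ->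
  (forall x, fermion x true u = 0) ->
  u = u@_vac *: fock_vac C.
Proof.
move=> ub uf; apply/malgP => k; rewrite mcoeffZ mcoeffU.
have [<-|nvac] := eqVneq vac k; first by rewrite mulr1.
rewrite mulr0; apply/eqP; case: (state_cases k) => [kvac|[f [i ki]]|[x kx]].
- by rewrite kvac eqxx in nvac.
- have /(congr1 (mcoeff (del_boson f i k))) := ub (~~ f) i.
  rewrite mcoeff0 (@mcoeff_lin_ext _ _ _ _ u k) /=; last first.
    move=> k' kk'; rewrite mcoeffU negbK; case: eqVneq => // dk.
    case: (posnP (mult f i k')) => [->|k'i]; first by rewrite muln0 mul0rn.
    by rewrite -(del_bosonK k'i) dk del_bosonK ?eqxx in kk'.
  rewrite negbK mcoeffUU => /eqP; rewrite mulf_eq0 pnatr_eq0 !muln_eq0 /=.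
  by rewrite eqn0Ngt ki orbF.
- have /(congr1 (mcoeff (toggle_state x k))) := uf x.
  rewrite mcoeff0 (@mcoeff_lin_ext _ _ _ _ u k) /=; last first.
    move=> k' kk'; case: (_ == true); last exact: mcoeff0.
    rewrite mcoeffU; case: eqVneq => // dk.
    by rewrite -(toggle_stateK x k') dk toggle_stateK eqxx in kk'.
  by rewrite kx mcoeffUU => /eqP; rewrite mulf_eq0 signr_eq0 orbF.
Qed.

Definition has_degree (e : int) (T : fock C -> fock C) : Prop :=
  forall u k, k \in msupp (T u) ->
    exists2 k', k' \in msupp u & (weight k)%:Z = (weight k')%:Z + e.

Lemma msupp_sum (I : eqType) (r : seq I) (F : I -> fock C) k :
  k \in msupp (\sum_(i <- r) F i) -> exists2 i, i \in r & k \in msupp (F i).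
Proof.
elim: r => [|i r IHr]; first by rewrite big_nil msupp0.
rewrite big_cons => /(fsubsetP (msuppD_le _ _)); rewrite in_fsetU => /orP[ki|/IHr[j jr kj]].
  by exists i; rewrite ?mem_head.
by exists j; rewrite // in_cons jr orbT.
Qed.

Lemma has_degree_sum (I : eqType) (r : fock C -> seq I)
    (F : I -> fock C -> fock C) e :
  (forall i, has_degree e (F i)) -> has_degree e (fun u => \sum_(i <- r u) F i u).
Proof. by move=> Fe u k /msupp_sum[i _ /Fe]. Qed.

Lemma has_degreeD S T e : has_degree e S -> has_degree e T ->
  has_degree e (fun u => S u + T u).
Proof.
move=> Se Te u k /(fsubsetP (msuppD_le _ _)).
by rewrite in_fsetU => /orP[/Se|/Te].
Qed.

Lemma has_degreeZ a T e : has_degree e T -> has_degree e (fun u => a *: T u).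
Proof. by move=> Te u k /(fsubsetP (msuppZ_le _ _)) /Te. Qed.

Lemma has_degreeN T e : has_degree e T -> has_degree e (fun u => - T u).
Proof. by move=> Te u k; rewrite msuppN => /Te. Qed.

Lemma has_degree_comp S T d e : has_degree d S -> has_degree e T ->
  has_degree (d + e) (fun u => S (T u)).
Proof.
move=> Sd Te u k /Sd[l /Te[k' uk' lE] kE]; exists k' => //.
by rewrite kE lE -addrA [e + d]addrC.
Qed.

Lemma has_degree_id : has_degree 0 id.
Proof. by move=> u k uk; exists k; rewrite ?addr0. Qed.

Lemma has_degree0 e : has_degree e (fun=> 0).
Proof. by move=> u k; rewrite msupp0. Qed.

Lemma has_degree_lin_ext (F : state -> fock C) e :
  (forall k' k, k \in msupp (F k') -> (weight k)%:Z = (weight k')%:Z + e) ->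
  has_degree e (lin_ext F).
Proof.
move=> Fe u k /msupp_sum[k' uk' /(fsubsetP (msuppZ_le _ _)) /Fe kE].
by exists k'.
Qed.

Lemma boson_degree f (z : C) n : has_degree (- (2 * n)) (boson f z n).
Proof.
apply: has_degree_lin_ext => k' k; case: n => [[|i]|i]; rewrite /boson_on.
- by move/(fsubsetP msuppU_le); rewrite in_fset1 => /eqP ->; rewrite addr0.
- case: (posnP (mult (~~ f) i k')) => [->|ki]; first by rewrite muln0 monalgU0 msupp0.
  by move/(fsubsetP msuppU_le); rewrite in_fset1 => /eqP ->; rewrite (weight_del ki); lia.
- by move/(fsubsetP msuppU_le); rewrite in_fset1 => /eqP ->; rewrite weight_add; lia.
Qed.

Lemma fermion_degree x b :
  has_degree (if b then - x.2.*2.+1%:Z else x.2.*2.+1%:Z) (fermion x b).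
Proof.
apply: has_degree_lin_ext => k' k; case: eqP => [xb|_]; last by rewrite msupp0.
move/(fsubsetP msuppU_le); rewrite in_fset1 => /eqP ->.
case: b xb => kx; first by rewrite (weight_toggle kx); lia.
have /weight_toggle -> : occupied x (toggle_state x k').
  by rewrite occupied_toggle kx eqxx.
by rewrite toggle_stateK; lia.
Qed.

End FockSpace.

(** * Vector identities *)

Section Coefficients.
Variable C : numClosedFieldType.
Implicit Types (u v : fock C) (l : state) (x y : C).

Definition coef l u : C := u@_l.

Lemma coefP u v : (forall l, coef l u = coef l v) -> u = v.
Proof. by move=> uv; apply/malgP. Qed.

Lemma coef_add l u v x y : coef l u = x -> coef l v = y -> coef l (u + v) = x + y.
Proof. by move=> <- <-; apply: mcoeffD. Qed.

Lemma coef_opp l u x : coef l u = x -> coef l (- u) = - x.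
Proof. by move=> <-; apply: mcoeffN. Qed.

Lemma coef_scale l a u x : coef l u = x -> coef l (a *: u) = a * x.
Proof. by move=> <-; apply: mcoeffZ. Qed.

Lemma coef_zero l : coef l 0 = 0.
Proof. exact: mcoeff0. Qed.

End Coefficients.

(** An equality of linear combinations of vectors is reduced to an equality of
    scalars, with one unknown for each vector.  The proof that a coefficient is
    linear is assembled by syntactic matching, so that two distinct vectors of
    the Fock space are never compared up to conversion. *)
Ltac coef_expand C l u :=
  lazymatch u with
  | (?v + ?w)%R => let p := coef_expand C l v in let q := coef_expand C l w in
                   constr:(coef_add p q)
  | (- ?v)%R => let p := coef_expand C l v in constr:(coef_opp p)
  | (?a *: ?v)%R => let p := coef_expand C l v in constr:(coef_scale a p)
  | 0%R => constr:(coef_zero C l)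
  | _ => constr:(erefl (coef l u))
  end.

Ltac coef_goal :=
  apply: coefP; let l := fresh "l" in intro l;
  lazymatch goal with |- @coef ?C _ ?u = coef _ ?v =>
    let p := coef_expand C l u in let q := coef_expand C l v in
    refine (eq_trans p (eq_trans _ (esym q)))
  end;
  repeat match goal with |- context [coef l ?w] =>
    let z := fresh "z" in generalize (coef l w); intro z end;
  clear l.

(** * Fields and normally ordered products *)

Section NormalOrdering.
Variable C : numClosedFieldType.
Implicit Types (a b : field C) (u v : fock C) (n k : int).

(** With [A] twice the conformal weight of the state minus two, the [n]-th mode
    of its field shifts doubled weights by [A - 2 n]. *)
Definition graded_field (A : int) a : Prop :=
  (forall n, linear (a n)) /\ (forall n, has_degree (A - 2 * n) (a n)).

Lemma c_field_graded (z : C) : graded_field 0 (c_field z).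
Proof.
split=> n; first exact: lin_ext_linear.
by move=> u k; rewrite c_fieldE add0r; apply: boson_degree.
Qed.

Lemma d_field_graded (z : C) : graded_field 0 (d_field z).
Proof.
split=> n; first exact: lin_ext_linear.
by move=> u k; rewrite d_fieldE add0r; apply: boson_degree.
Qed.

Lemma psip_field_graded : graded_field (-1) (@psip_field C).
Proof.
split=> n; first exact: psip_linear.
move=> u k; rewrite psipE; case: n => i /fermion_degree[k' uk' ->]; exists k' => //=;
  by lia.
Qed.

Lemma psim_field_graded : graded_field (-1) (@psim_field C).
Proof.
split=> n; first exact: psim_linear.
move=> u k; rewrite psimE; case: n => i /fermion_degree[k' uk' ->]; exists k' => //=;
  by lia.
Qed.

Lemma deriv_graded A a : graded_field A a -> graded_field (A + 2) (deriv_field a).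
Proof.
move=> [a_lin a_deg]; split=> n => [z u v|u k].
  by rewrite /deriv_field a_lin scalerDr !scalerA mulrC.
move=> /(has_degreeZ (a_deg _)) [k' uk' ->]; exists k' => //; lia.
Qed.

(** There are no states of negative weight. *)
Lemma graded_vanish A a u : graded_field A a ->
  exists N : nat, forall n, N%:Z <= n -> a n u = 0.
Proof.
move=> [_ a_deg]; pose M := (\sum_(k <- msupp u) weight k)%N.
have leM (l : state) : l \in msupp u -> (weight l <= M)%N.
  by move=> uk; rewrite /M (big_fsetD1 l) //= leq_addr.
exists (M + `|A| + 1)%N => n Nn; apply/malgP => k; rewrite mcoeff0; apply/eqP.
by apply: contraT; rewrite mcoeff_neq0 => /a_deg[k' /leM]; lia.
Qed.

Section Product.
Variables (A B : int) (o : bool) (a b : field C).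
Hypotheses (aA : graded_field A a) (bB : graded_field B b).

Definition nop_term n u (j : nat) : fock C :=
  a (- 1 - j%:Z) (b (n + j%:Z) u) + (-1) ^+ o *: b (n - 1 - j%:Z) (a j%:Z u).

Lemma nop_finite n u : exists N : nat, forall M, (N <= M)%N ->
  nop o a b n u = \sum_(j < M) nop_term n u j.
Proof.
have [Na aN] := graded_vanish u aA; have [Nb bN] := graded_vanish u bB.
exists (Na + Nb + `|n|)%N => M NM; rewrite -(big_mkord xpredT (nop_term n u)).
rewrite /nop (fsbigE (index_iota 0 M)) //=.
- by apply: eq_big => // j; rewrite in_setT.
- exact: iota_uniq.
- move=> j _; rewrite mem_index_iota /= -leqNgt => Mj.
  by rewrite bN ?aN ?(lin0 (aA.1 _)) ?(lin0 (bB.1 _)) ?scaler0 ?addr0 //; lia.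
Qed.

Lemma nop_linear n : linear (nop o a b n).
Proof.
move=> z u v; have [N1 E1] := nop_finite n u; have [N2 E2] := nop_finite n v.
have [N3 E3] := nop_finite n (z *: u + v).
pose M := (N1 + N2 + N3)%N; rewrite (E1 M) ?(E2 M) ?(E3 M) /M; [|lia..].
rewrite scaler_sumr -big_split; apply: eq_bigr => j _; rewrite /nop_term.
rewrite !(aA.1, bB.1) !scalerDr !scalerA ![_ * z]mulrC.
exact: addrACA.
Qed.

Lemma nop_degree n : has_degree (A + B + 2 - 2 * n) (nop o a b n).
Proof.
apply: has_degree_sum => j; apply: has_degreeD; last apply: has_degreeZ.
  have := has_degree_comp (aA.2 (-1 - j%:Z)) (bB.2 (n + j%:Z)).
  by congr (has_degree _ _); lia.
have := has_degree_comp (bB.2 (n - 1 - j%:Z)) (aA.2 j%:Z).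
by congr (has_degree _ _); lia.
Qed.

Lemma nop_graded : graded_field (A + B + 2) (nop o a b).
Proof. by split; [exact: nop_linear|exact: nop_degree]. Qed.

(** Each integer is [j] or [-1 - j] for exactly one natural number [j], so the
    two halves of a normally ordered product contribute one contraction. *)
Lemma delta_sum (V : lmodType C) (f : int -> V) k (M : nat) : (`|k| < M)%N ->
  \sum_(j < M) (((-1 - j%:Z == k)%:R : C) *: f (-1 - j%:Z)
                + ((j%:Z == k)%:R : C) *: f j%:Z) = f k.
Proof.
move=> kM; rewrite big_split /=; case: k kM => i iM.
- rewrite big1 ?add0r => [|j _]; last by rewrite (_ : (_ == _) = false) ?scale0r //; lia.
  rewrite (bigD1 (Ordinal iM)) //= eqxx scale1r big1 ?addr0 // => j ji.
  rewrite (_ : (_ == _) = false) ?scale0r //; apply: contraNF ji => /eqP[ji].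
  by apply/eqP/val_inj.
rewrite addrC big1 ?add0r => [|j _]; last by rewrite (_ : (_ == _) = false) ?scale0r //; lia.
have iM' : (i < M)%N by lia.
rewrite (bigD1 (Ordinal iM')) //= (_ : -1 - i%:Z = Negz i); last by lia.
rewrite eqxx scale1r big1 ?addr0 // => j ji.
rewrite (_ : (_ == _) = false) ?scale0r //; apply: contraNF ji => /eqP ji.
by apply/eqP/val_inj => /=; lia.
Qed.

(** Commuting [X] through a normally ordered product contracts [X] with either
    factor; the infinitely many terms leave one contraction for each factor. *)
Lemma nop_comm (X : fock C -> fock C) (ea eb sa sb : C) k1 k2 : linear X ->
  (forall i u, X (a i u) = ea *: a i (X u) + ((i == k1)%:R * sa) *: u) ->
  (forall i u, X (b i u) = eb *: b i (X u) + ((i == k2)%:R * sb) *: u) ->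
  (-1) ^+ o * eb * sa = sa -> (-1) ^+ o * sb = ea * sb ->
  forall n u, X (nop o a b n u) = (ea * eb) *: nop o a b n (X u)
    + sa *: b (n - 1 - k1) u + (ea * sb) *: a (n - 1 - k2) u.
Proof.
move=> X_lin Xa Xb Esa Esb n u.
have [N1 E1] := nop_finite n u; have [N2 E2] := nop_finite n (X u).
pose M := (N1 + N2 + `|k1| + `|(n - 1 - k2)%R| + 1)%N.
rewrite (E1 M) ?(E2 M) /M; [|lia..]; rewrite -/M (lin_sum X_lin).
rewrite -(@delta_sum _ (fun i => b (n - 1 - i) u) k1 M); last by rewrite /M; lia.
rewrite -(@delta_sum _ (fun i => a i u) (n - 1 - k2) M); last by rewrite /M; lia.
rewrite !scaler_sumr -!big_split; apply: eq_bigr => j _ /=; rewrite /nop_term.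
rewrite (linD X_lin) (linZ X_lin) Xa !Xb Xa.
rewrite !(linD (aA.1 _)) !(linD (bB.1 _)) !(linZ (aA.1 _)) !(linZ (bB.1 _)).
rewrite (_ : n - 1 - (-1 - j%:Z) = n + j%:Z); last by lia.
rewrite (_ : (-1 - j%:Z == n - 1 - k2) = (n + j%:Z == k2)); last by lia.
rewrite (_ : (j%:Z == n - 1 - k2) = (n - 1 - j%:Z == k2)); last by lia.
move: (a _ (b _ (X u))) (b _ (a _ (X u))) (a _ u) (a _ u) (b _ u) (b _ u).
move: (_%:R) (_%:R) (_%:R) (_%:R) => d1 d2 d3 d4 w1 w2 w3 w4 w5 w6.
coef_goal; ring: Esa Esb.
Qed.

Lemma nop_commS (X : fock C -> fock C) (ea eb sa sb e : C) k1 k2 : linear X ->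
  (forall i u, X (a i u) = ea *: a i (X u) + ((i == k1)%:R * sa) *: u) ->
  (forall i u, X (b i u) = eb *: b i (X u) + ((i == k2)%:R * sb) *: u) ->
  (-1) ^+ o * eb * sa = sa -> (-1) ^+ o * sb = ea * sb -> ea * eb = e ->
  forall n u, X (nop o a b (n + 1) u) = e *: nop o a b (n + 1) (X u)
    + sa *: b (n - k1) u + (ea * sb) *: a (n - k2) u.
Proof.
move=> X_lin Xa Xb Esa Esb <- n u.
have := nop_comm X_lin Xa Xb Esa Esb (n + 1) u.
by rewrite (_ : n + 1 - 1 = n) ?addrK.
Qed.

End Product.
End NormalOrdering.

(** * Commutators of the free fields with the generating fields *)

Section FreeCommutators.
Variables (C : numClosedFieldType) (cL : C) (gamma : heis C).
Implicit Types (u : fock C) (n k : int) (X : fock C -> fock C).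

Local Notation c := (c_field (heis_form (heis_c C) gamma)).
Local Notation d := (d_field (heis_form (heis_d C) gamma)).
Local Notation psip := (@psip_field C).
Local Notation psim := (@psim_field C).
Local Notation tau := (tau_field cL gamma).
Local Notation omega := (omega_field cL gamma).
Local Notation q := (sqrtC (2 : C)).

(** The (super)commutators of [X] with the free fields are scalars, each
    vanishing on all modes but one; [e] is the sign of [X] against fermions. *)
Definition free_comm X (e sc sd sp sm : C) (kc kd kp km : int) : Prop :=
  [/\ forall i u, X (c i u) = c i (X u) + ((i == kc)%:R * sc) *: u,
      forall i u, X (d i u) = d i (X u) + ((i == kd)%:R * sd) *: u,
      forall i u, X (psip i u) = e *: psip i (X u) + ((i == kp)%:R * sp) *: u
    & forall i u, X (psim i u) = e *: psim i (X u) + ((i == km)%:R * sm) *: u].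

Let cG := c_field_graded (heis_form (heis_c C) gamma).
Let dG := d_field_graded (heis_form (heis_d C) gamma).
Let pG := psip_field_graded C.
Let mG := psim_field_graded C.

Lemma deriv_comm X (a : field C) (e s : C) k : linear X ->
  (forall i u, X (a i u) = e *: a i (X u) + ((i == k)%:R * s) *: u) ->
  forall i u, X (deriv_field a i u) =
    e *: deriv_field a i (X u) + ((i == k + 1)%:R * (- (k + 1)%:~R * s)) *: u.
Proof.
move=> X_lin Xa i u; rewrite /deriv_field (linZ X_lin) Xa.
rewrite (_ : (i - 1 == k) = (i == k + 1)); last by lia.
by case: eqP => [->|_]; rewrite ?mul1r ?mul0r; coef_goal; ring.
Qed.

Lemma deriv_commS X (a : field C) (e s : C) k : linear X ->
  (forall i u, X (a i u) = e *: a i (X u) + ((i == k)%:R * s) *: u) ->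
  forall n u, X (deriv_field a (n + 1) u) = e *: deriv_field a (n + 1) (X u)
    + ((n == k)%:R * (- (n + 1)%:~R * s)) *: u.
Proof.
move=> X_lin Xa n u; rewrite /deriv_field (linZ X_lin) Xa addrK.
by coef_goal; ring.
Qed.

(** The shapes of the defining combinations of tau and omega. *)
Section Combinations.
Variables (U V : lmodType C) (f : U -> V) (a1 a2 a3 a4 : C).
Variables (v1 v2 v3 v4 v5 : U) (w1 w2 w3 w4 w5 : V).
Hypothesis f_lin : linear f.
Hypotheses (E1 : f v1 = w1) (E2 : f v2 = w2) (E3 : f v3 = w3).
Hypotheses (E4 : f v4 = w4) (E5 : f v5 = w5).

Lemma lin_tau : f (a1 *: (a2 *: v1 + a3 *: v2 + a4 *: v3 - v4)) =
  a1 *: (a2 *: w1 + a3 *: w2 + a4 *: w3 - w4).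
Proof. by rewrite -E1 -E2 -E3 -E4 !(linZ f_lin, linD f_lin, linN f_lin). Qed.

Lemma lin_omega : f (a1 *: v1 + a2 *: v2 - a3 *: v3 + a4 *: (v4 + v5)) =
  a1 *: w1 + a2 *: w2 - a3 *: w3 + a4 *: (w4 + w5).
Proof. by rewrite -E1 -E2 -E3 -E4 -E5 !(linZ f_lin, linD f_lin, linN f_lin). Qed.

End Combinations.

(** The four families of free modes are treated at once. *)
Section OneOperator.
Variables (X : fock C -> fock C) (e sc sd sp sm : C) (kc kd kp km : int).
Hypotheses (X_lin : linear X) (XP : free_comm X e sc sd sp sm kc kd kp km).
Hypotheses (e_sc : e * sc = sc) (e_sd : e * sd = sd).
Hypotheses (e_sp : e * sp = - sp) (e_sm : e * sm = - sm) (e_sign : e * e = 1).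

Let Xc i u : X (c i u) = 1 *: c i (X u) + ((i == kc)%:R * sc) *: u.
Proof. by case: XP => H _ _ _; rewrite H scale1r. Qed.
Let Xd i u : X (d i u) = 1 *: d i (X u) + ((i == kd)%:R * sd) *: u.
Proof. by case: XP => _ H _ _; rewrite H scale1r. Qed.
Let Xp : forall i u, X (psip i u) = e *: psip i (X u) + ((i == kp)%:R * sp) *: u.
Proof. by case: XP. Qed.
Let Xm : forall i u, X (psim i u) = e *: psim i (X u) + ((i == km)%:R * sm) *: u.
Proof. by case: XP. Qed.


Let sign_left s : e * s = s -> (-1) ^+ false * e * s = s.
Proof. by rewrite expr0 mul1r. Qed.
Let sign_right (s : C) : (-1) ^+ false * s = 1 * s.
Proof. by rewrite expr0. Qed.
Let sign_one (s : C) : (-1) ^+ false * 1 * s = s.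
Proof. by rewrite expr0 !mul1r. Qed.
Let sign_deriv s (k : int) : e * s = - s ->
  (-1) ^+ true * e * (- (k + 1)%:~R * s) = - (k + 1)%:~R * s.
Proof. by move=> es; ring: es. Qed.
Let sign_odd s : e * s = - s -> (-1) ^+ true * s = e * s.
Proof. by move=> ->; rewrite expr1 mulN1r. Qed.

Lemma tau_comm n u : X (tau (n + 1) u) = e *: tau (n + 1) (X u)
  + (q / 2 * sc) *: psip (n - kc) u + (q / 2 * sp) *: c (n - kp) u
  + (q / 2 * sd) *: psim (n - kd) u + (q / 2 * sm) *: d (n - km) u
  + (q * (n + 1)%:~R * ((n == kp)%:R * sp
      - (cL - 3) / 12 * ((n == km)%:R * sm))) *: u.
Proof.
have E1 := nop_commS cG pG X_lin Xc Xp (sign_left e_sc) (sign_right _) (mul1r e) n u.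
have E2 := nop_commS dG mG X_lin Xd Xm (sign_left e_sd) (sign_right _) (mul1r e) n u.
have E3 := deriv_commS X_lin Xm n u.
have E4 := deriv_commS X_lin Xp n u.
rewrite /tau_field (lin_tau _ _ _ _ X_lin E1 E2 E3 E4).
coef_goal; ring.
Qed.

Lemma omega_comm n u : X (omega (n + 1) u) = omega (n + 1) (X u)
  + (sc / 2) *: d (n - kc) u + (sd / 2) *: c (n - kd) u
  + ((n + 1)%:~R * (2^-1 * ((n == kd)%:R * sd)
      - (cL - 3) / 24 * ((n == kc)%:R * sc))) *: u
  + (2^-1 * sm * (n - 2 * km - 1)%:~R) *: psip (n - km - 1) u
  + (2^-1 * sp * (n - 2 * kp - 1)%:~R) *: psim (n - kp - 1) u.
Proof.
have Dp := deriv_comm X_lin Xp; have Dm := deriv_comm X_lin Xm.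
have pG' := deriv_graded pG; have mG' := deriv_graded mG.
have E1 := nop_commS cG dG X_lin Xc Xd (sign_one sc) (sign_right sd) (mul1r 1) n u.
have E2 := deriv_commS X_lin Xc n u.
have E3 := deriv_commS X_lin Xd n u.
have E4 := nop_commS pG' mG X_lin Dp Xm (sign_deriv _ e_sp) (sign_odd e_sm) e_sign n u.
have E5 := nop_commS mG' pG X_lin Dm Xp (sign_deriv _ e_sm) (sign_odd e_sp) e_sign n u.
rewrite /omega_field /omega_fer_field (lin_omega _ _ _ _ X_lin E1 E2 E3 E4 E5).
rewrite /deriv_field.
rewrite (_ : n - (km + 1) = n - km - 1); last by lia.
rewrite (_ : n - (kp + 1) = n - kp - 1); last by lia.
by coef_goal; rewrite e_sp e_sm; field.
Qed.

End OneOperator.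

Lemma cc_comm (z w : C) m n u :
  c_field z m (c_field w n u) = c_field w n (c_field z m u).
Proof. by rewrite !c_fieldE boson_comm mul0r scale0r addr0. Qed.

Lemma dd_comm (z w : C) m n u :
  d_field z m (d_field w n u) = d_field w n (d_field z m u).
Proof. by rewrite !d_fieldE boson_comm mul0r scale0r addr0. Qed.

Lemma cd_comm (z w : C) m n u : c_field z m (d_field w n u) =
  d_field w n (c_field z m u) + ((n == - m)%:R * (2 * m%:~R)) *: u.
Proof.
rewrite c_fieldE d_fieldE boson_comm -c_fieldE -d_fieldE.
by rewrite [m + n]addrC addr_eq0.
Qed.

Lemma dc_comm (z w : C) m n u : d_field z m (c_field w n u) =
  c_field w n (d_field z m u) + ((n == - m)%:R * (2 * m%:~R)) *: u.
Proof.
rewrite c_fieldE d_fieldE boson_comm -c_fieldE -d_fieldE.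
by rewrite [m + n]addrC addr_eq0.
Qed.

Lemma cp_comm (z : C) m n u : c_field z m (psip n u) = psip n (c_field z m u).
Proof. by rewrite !c_fieldE !psipE; case: n => i; rewrite boson_fermion. Qed.

Lemma cm_comm (z : C) m n u : c_field z m (psim n u) = psim n (c_field z m u).
Proof. by rewrite !c_fieldE !psimE; case: n => i; rewrite boson_fermion. Qed.

Lemma dp_comm (z : C) m n u : d_field z m (psip n u) = psip n (d_field z m u).
Proof. by rewrite !d_fieldE !psipE; case: n => i; rewrite boson_fermion. Qed.

Lemma dm_comm (z : C) m n u : d_field z m (psim n u) = psim n (d_field z m u).
Proof. by rewrite !d_fieldE !psimE; case: n => i; rewrite boson_fermion. Qed.

Let contraction0 (i k : int) (v w x : fock C) :
  v = w -> v = w + ((i == k)%:R * 0) *: x.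
Proof. by move=> ->; rewrite mulr0 scale0r addr0. Qed.

Let scale1 (v w : fock C) : v = w -> v = 1 *: w.
Proof. by rewrite scale1r. Qed.

Let scaleN1 (v w : fock C) : v = - w -> v = - 1 *: w.
Proof. by rewrite scaleN1r. Qed.

Lemma free_comm_c (k : int) : free_comm (c k) 1 0 (2 * k%:~R) 0 0 0 (- k) 0 0.
Proof.
split=> i u.
- exact/contraction0/cc_comm.
- exact: cd_comm.
- exact/contraction0/scale1/cp_comm.
- exact/contraction0/scale1/cm_comm.
Qed.

Lemma free_comm_d (k : int) : free_comm (d k) 1 (2 * k%:~R) 0 0 0 (- k) 0 0 0.
Proof.
split=> i u.
- exact: dc_comm.
- exact/contraction0/dd_comm.
- exact/contraction0/scale1/dp_comm.
- exact/contraction0/scale1/dm_comm.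
Qed.

Lemma free_comm_p (k : int) : free_comm (psip k) (- 1) 0 0 0 1 0 0 0 (- k - 1).
Proof.
split=> i u.
- apply/contraction0; exact/esym/cp_comm.
- apply/contraction0; exact/esym/dp_comm.
- exact/contraction0/scaleN1/psipp.
- rewrite psipm scaleN1r mulr1; congr (_ + _%:R *: _).
  by congr nat_of_bool; lia.
Qed.

Lemma free_comm_m (k : int) : free_comm (psim k) (- 1) 0 0 1 0 0 0 (- k - 1) 0.
Proof.
split=> i u.
- apply/contraction0; exact/esym/cm_comm.
- apply/contraction0; exact/esym/dm_comm.
- rewrite psimp scaleN1r mulr1; congr (_ + _%:R *: _).
  by congr nat_of_bool; lia.
- exact/contraction0/scaleN1/psimm.
Qed.

Let zN : - 1 * 0 = 0 :> C. Proof. by rewrite mulr0. Qed.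
Let zN1 : - 1 * 0 = - 0 :> C. Proof. by rewrite mulr0 oppr0. Qed.
Let sN : - 1 * - 1 = 1 :> C. Proof. by rewrite mulN1r opprK. Qed.

Lemma c_tau (k n : int) u : c k (tau (n + 1) u) =
  tau (n + 1) (c k u) + (q * k%:~R) *: psim (n + k) u.
Proof.
rewrite (tau_comm (cG.1 _) (free_comm_c k)) ?mul1r ?mulr0 ?oppr0 //.
by rewrite opprK; coef_goal; field.
Qed.

Lemma d_tau (k n : int) u : d k (tau (n + 1) u) =
  tau (n + 1) (d k u) + (q * k%:~R) *: psip (n + k) u.
Proof.
rewrite (tau_comm (dG.1 _) (free_comm_d k)) ?mul1r ?mulr0 ?oppr0 //.
by rewrite opprK; coef_goal; field.
Qed.

Lemma psip_tau (k n : int) u : psip k (tau (n + 1) u) =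
  - tau (n + 1) (psip k u) + (q / 2) *: d (n + k + 1) u
  - (q * (n + 1)%:~R * ((cL - 3) / 12) * (n + k + 1 == 0)%:R) *: u.
Proof.
rewrite (tau_comm (psip_linear _) (free_comm_p k) zN zN).
rewrite (_ : n - (- k - 1) = n + k + 1); last by lia.
rewrite (_ : (n == - k - 1) = (n + k + 1 == 0)); last by lia.
by coef_goal; field.
Qed.

Lemma psim_tau (k n : int) u : psim k (tau (n + 1) u) =
  - tau (n + 1) (psim k u) + (q / 2) *: c (n + k + 1) u
  + (q * (n + 1)%:~R * (n + k + 1 == 0)%:R) *: u.
Proof.
rewrite (tau_comm (psim_linear _) (free_comm_m k) zN zN).
rewrite (_ : n - (- k - 1) = n + k + 1); last by lia.
rewrite (_ : (n == - k - 1) = (n + k + 1 == 0)); last by lia.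
by coef_goal; field.
Qed.

Lemma c_omega (k n : int) u : c k (omega (n + 1) u) =
  omega (n + 1) (c k u) + k%:~R *: c (n + k) u
  + (k%:~R * (n + 1)%:~R * (n + k == 0)%:R) *: u.
Proof.
rewrite (omega_comm (cG.1 _) (free_comm_c k)) ?mul1r ?mulr0 ?oppr0 //.
rewrite opprK (_ : (n == - k) = (n + k == 0)); last by lia.
by coef_goal; field.
Qed.

Lemma d_omega (k n : int) u : d k (omega (n + 1) u) =
  omega (n + 1) (d k u) + k%:~R *: d (n + k) u
  - ((cL - 3) / 12 * k%:~R * (n + 1)%:~R * (n + k == 0)%:R) *: u.
Proof.
rewrite (omega_comm (dG.1 _) (free_comm_d k)) ?mul1r ?mulr0 ?oppr0 //.
rewrite opprK (_ : (n == - k) = (n + k == 0)); last by lia.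
by coef_goal; field.
Qed.

Lemma psip_omega (k n : int) u : psip k (omega (n + 1) u) =
  omega (n + 1) (psip k u) + (k%:~R + (n + 1)%:~R / 2) *: psip (n + k) u.
Proof.
rewrite (omega_comm (psip_linear _) (free_comm_p k) zN1 (mulr1 _) sN).
rewrite (_ : n - (- k - 1) - 1 = n + k); last by lia.
by coef_goal; field.
Qed.

Lemma psim_omega (k n : int) u : psim k (omega (n + 1) u) =
  omega (n + 1) (psim k u) + (k%:~R + (n + 1)%:~R / 2) *: psim (n + k) u.
Proof.
rewrite (omega_comm (psim_linear _) (free_comm_m k) (mulr1 _) zN1 sN).
rewrite (_ : n - (- k - 1) - 1 = n + k); last by lia.
by coef_goal; field.
Qed.

End FreeCommutators.

(** * Reduction of the commutation relations to the vacuum *)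

(** Only the commutators with the free fields enter, so that the fields may be
    arbitrary families of operators. *)
Section Defects.
Variables (C : numClosedFieldType) (cL : C).
Variables (c d p m G L : int -> fock C -> fock C).
Implicit Types (u : fock C) (i j k : int).

Local Notation q := (sqrtC (2 : C)).

Hypotheses (c_lin : forall k, linear (c k)) (d_lin : forall k, linear (d k)).
Hypotheses (p_lin : forall k, linear (p k)) (m_lin : forall k, linear (m k)).
Hypotheses (G_lin : forall k, linear (G k)) (L_lin : forall k, linear (L k)).
Hypothesis cG : forall k i u, c k (G i u) = G i (c k u) + (q * k%:~R) *: m (i + k) u.
Hypothesis dG : forall k i u, d k (G i u) = G i (d k u) + (q * k%:~R) *: p (i + k) u.
Hypothesis pG : forall k i u, p k (G i u) = - G i (p k u) + (q / 2) *: d (i + k + 1) u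
  - (q * (i + 1)%:~R * ((cL - 3) / 12) * (i + k + 1 == 0)%:R) *: u.
Hypothesis mG : forall k i u, m k (G i u) = - G i (m k u) + (q / 2) *: c (i + k + 1) u
  + (q * (i + 1)%:~R * (i + k + 1 == 0)%:R) *: u.
Hypothesis cLc : forall k i u, c k (L i u) = L i (c k u) + k%:~R *: c (i + k) u
  + (k%:~R * (i + 1)%:~R * (i + k == 0)%:R) *: u.
Hypothesis dLd : forall k i u, d k (L i u) = L i (d k u) + k%:~R *: d (i + k) u
  - ((cL - 3) / 12 * k%:~R * (i + 1)%:~R * (i + k == 0)%:R) *: u.
Hypothesis pL : forall k i u, p k (L i u) =
  L i (p k u) + (k%:~R + (i + 1)%:~R / 2) *: p (i + k) u.
Hypothesis mL : forall k i u, m k (L i u) =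
  L i (m k u) + (k%:~R + (i + 1)%:~R / 2) *: m (i + k) u.

Definition defect_GG i j u : fock C :=
  G i (G j u) + G j (G i u) - 2 *: L (i + j + 1) u
  - ((i + j + 1 == 0)%:R * ((i ^+ 2 + i)%:~R / 3) * cL) *: u.

Definition defect_LG i j u : fock C :=
  L i (G j u) - G j (L i u) - (i%:~R / 2 - j%:~R - 1 / 2) *: G (i + j) u.

Let qq : q * q = 2. Proof. by rewrite -expr2 sqrtCK. Qed.

Lemma defect_GG_linear i j : linear (defect_GG i j).
Proof.
move=> a u v; rewrite /defect_GG !(G_lin, L_lin).
by coef_goal; ring.
Qed.

Lemma defect_LG_linear i j : linear (defect_LG i j).
Proof.
move=> a u v; rewrite /defect_LG !(G_lin, L_lin).
by coef_goal; ring.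
Qed.

Lemma c_defect_GG k i j u : c k (defect_GG i j u) = defect_GG i j (c k u).
Proof.
rewrite /defect_GG !(linB (c_lin k)) (linD (c_lin k)) !(linZ (c_lin k)) cLc.
rewrite !cG !(linD (G_lin _)) !(linZ (G_lin _)) !mG.
rewrite (_ : j + (i + k) + 1 = i + j + 1 + k); last by lia.
rewrite (_ : i + (j + k) + 1 = i + j + 1 + k); last by lia.
by coef_goal; field: qq.
Qed.

Lemma d_defect_GG k i j u : d k (defect_GG i j u) = defect_GG i j (d k u).
Proof.
rewrite /defect_GG !(linB (d_lin k)) (linD (d_lin k)) !(linZ (d_lin k)) dLd.
rewrite !dG !(linD (G_lin _)) !(linZ (G_lin _)) !pG.
rewrite (_ : j + (i + k) + 1 = i + j + 1 + k); last by lia.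
rewrite (_ : i + (j + k) + 1 = i + j + 1 + k); last by lia.
by coef_goal; field: qq.
Qed.

Lemma p_defect_GG k i j u : p k (defect_GG i j u) = 1 *: defect_GG i j (p k u).
Proof.
rewrite /defect_GG !(linB (p_lin k)) (linD (p_lin k)) !(linZ (p_lin k)) pL.
rewrite !pG !(linB (G_lin _)) !(linD (G_lin _)) !(linN (G_lin _)) !(linZ (G_lin _)) !dG.
rewrite (_ : j + (i + k + 1) = i + j + 1 + k); last by lia.
rewrite (_ : i + (j + k + 1) = i + j + 1 + k); last by lia.
by coef_goal; field: qq.
Qed.

Lemma m_defect_GG k i j u : m k (defect_GG i j u) = 1 *: defect_GG i j (m k u).
Proof.
rewrite /defect_GG !(linB (m_lin k)) (linD (m_lin k)) !(linZ (m_lin k)) mL.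
rewrite !mG !(linD (G_lin _)) !(linN (G_lin _)) !(linZ (G_lin _)) !cG.
rewrite (_ : j + (i + k + 1) = i + j + 1 + k); last by lia.
rewrite (_ : i + (j + k + 1) = i + j + 1 + k); last by lia.
by coef_goal; field: qq.
Qed.

Lemma c_defect_LG k i j u : c k (defect_LG i j u) = defect_LG i j (c k u).
Proof.
rewrite /defect_LG !(linB (c_lin k)) !(linZ (c_lin k)) cLc !cG cLc.
rewrite !(linD (G_lin _)) !(linD (L_lin _)) !(linZ (G_lin _)) !(linZ (L_lin _)) !mL.
rewrite (_ : j + (i + k) = i + j + k); last by lia.
rewrite (_ : i + (j + k) = i + j + k); last by lia.
by coef_goal; field.
Qed.

Lemma d_defect_LG k i j u : d k (defect_LG i j u) = defect_LG i j (d k u).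
Proof.
rewrite /defect_LG !(linB (d_lin k)) !(linZ (d_lin k)) dLd !dG dLd.
rewrite !(linB (G_lin _)) !(linD (G_lin _)) !(linD (L_lin _)).
rewrite !(linZ (G_lin _)) !(linZ (L_lin _)) !pL.
rewrite (_ : j + (i + k) = i + j + k); last by lia.
rewrite (_ : i + (j + k) = i + j + k); last by lia.
by coef_goal; field.
Qed.

(* On the diagonal k = -i-j-1 the scalars in front of the central terms cancel. *)
Let delta_cases i j k :
  (i + j + k + 1 == 0)%:R = 0 :> C \/ k = - (i + j) - 1.
Proof. by case: eqP => [|_]; [right; lia|left]. Qed.

Lemma p_defect_LG k i j u : p k (defect_LG i j u) = - 1 *: defect_LG i j (p k u).
Proof.
rewrite /defect_LG !(linB (p_lin k)) !(linZ (p_lin k)) pL !pG pL.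
rewrite !(linB (L_lin _)) !(linD (G_lin _)) !(linD (L_lin _)) !(linN (L_lin _)).
rewrite !(linZ (G_lin _)) !(linZ (L_lin _)) dLd.
rewrite (_ : j + (i + k) + 1 = i + j + k + 1); last by lia.
rewrite (_ : i + (j + k + 1) = i + j + k + 1); last by lia.
by case: (delta_cases i j k) => ->; coef_goal; field.
Qed.

Lemma m_defect_LG k i j u : m k (defect_LG i j u) = - 1 *: defect_LG i j (m k u).
Proof.
rewrite /defect_LG !(linB (m_lin k)) !(linZ (m_lin k)) mL !mG mL.
rewrite !(linD (G_lin _)) !(linD (L_lin _)) !(linN (L_lin _)).
rewrite !(linZ (G_lin _)) !(linZ (L_lin _)) cLc.
rewrite (_ : j + (i + k) + 1 = i + j + k + 1); last by lia.
rewrite (_ : i + (j + k + 1) = i + j + k + 1); last by lia.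
by case: (delta_cases i j k) => ->; coef_goal; field.
Qed.

End Defects.
Section Virasoro.
Variables (C : numClosedFieldType) (cL : C).
Variables (G L : int -> fock C -> fock C).
Implicit Types (u : fock C) (i j : int).

Hypotheses (G_lin : forall k, linear (G k)) (L_lin : forall k, linear (L k)).
Hypothesis GG_comm : forall i j u, G i (G j u) =
  - G j (G i u) + 2 *: L (i + j + 1) u
  + ((i + j + 1 == 0)%:R * ((i ^+ 2 + i)%:~R / 3) * cL) *: u.
Hypothesis LG_comm : forall i j u, L i (G j u) =
  G j (L i u) + (i%:~R / 2 - j%:~R - 1 / 2) *: G (i + j) u.

(** As [2 L(j) = {G(j - 1/2), G(1/2)}] has no central term, the commutators of
    the Virasoro modes, with their central term, follow from the other two. *)
Lemma LL_of_GG_LG i j u : L i (L j u) = L j (L i u) + (i - j)%:~R *: L (i + j) u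
  + ((i + j == 0)%:R * ((i ^+ 3 - i)%:~R / 12) * cL) *: u.
Proof.
have LE w : L j w = 2^-1 *: (G (j - 1) (G 0 w) + G 0 (G (j - 1) w)).
  rewrite (GG_comm (j - 1) 0) addr0 subrK.
  case: eqP => [->|_]; last by rewrite !mulr0n !mul0r; coef_goal; field.
  by rewrite mulr1n; coef_goal; field.
rewrite !LE (linZ (L_lin _)) (linD (L_lin _)) !LG_comm.
rewrite !(linD (G_lin _)) !(linZ (G_lin _)) addr0.
have -> : G (j - 1) (G i u) = - G i (G (j - 1) u) + 2 *: L (i + j) u
    + ((i + j == 0)%:R * ((i ^+ 2 + i)%:~R / 3) * cL) *: u.
  have := GG_comm i (j - 1) u; rewrite (_ : i + (j - 1) + 1 = i + j) => [->|]; last by lia.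
  by coef_goal; ring.
have -> : G (i + (j - 1)) (G 0 u) = - G 0 (G (i + (j - 1)) u) + 2 *: L (i + j) u.
  rewrite GG_comm (_ : i + (j - 1) + 0 + 1 = i + j); last by lia.
  case: eqP => [E|_].
    rewrite (_ : i + (j - 1) = - 1); last by lia.
    by rewrite mulr1n; coef_goal; field.
  by rewrite !mulr0n !mul0r; coef_goal; ring.
by coef_goal; field.
Qed.

End Virasoro.

(** * The commutation relations *)

Section FieldClosure.
Variable C : numClosedFieldType.
Implicit Types (a b : field C).

Lemma graded_fieldD A a b : graded_field A a -> graded_field A b ->
  graded_field A (fun n u => a n u + b n u).
Proof.
move=> [al ad] [bl bd]; split=> n; last exact: has_degreeD.
by move=> z u v; rewrite al bl scalerDr addrACA.
Qed.

Lemma graded_fieldZ A z a : graded_field A a ->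
  graded_field A (fun n u => z *: a n u).
Proof.
move=> [al ad]; split=> n; last exact: has_degreeZ.
by move=> y u v; rewrite al scalerDr !scalerA mulrC.
Qed.

Lemma graded_fieldN A a : graded_field A a -> graded_field A (fun n u => - a n u).
Proof.
move=> [al ad]; split=> n; last exact: has_degreeN.
by move=> y u v; rewrite al opprD scalerN.
Qed.

End FieldClosure.

(** Doubled, as the weights are. *)
Definition gen_degree (x : gen) : int :=
  match x with
  | gL n | gAlpha n => - (2 * n)
  | gG n | gPsi n => - (2 * n + 1)
  | _ => 0
  end.

Lemma positive_genE x : positive_gen x = (gen_degree x < 0).
Proof. by case: x => [n|n|n|n| | |] //=; lia. Qed.

Section Generators.
Variables (C : numClosedFieldType) (cL cLA : C) (gamma : heis C).
Implicit Types (u : fock C) (n k i j : int).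

Local Notation c := (c_field (heis_form (heis_c C) gamma)).
Local Notation d := (d_field (heis_form (heis_d C) gamma)).
Local Notation psip := (@psip_field C).
Local Notation psim := (@psim_field C).
Local Notation tau := (tau_field cL gamma).
Local Notation omega := (omega_field cL gamma).
Local Notation q := (sqrtC (2 : C)).
Local Notation act := (fock_act cL cLA gamma).

Let z1 : C := heis_form (heis_c C) gamma.
Let z2 : C := heis_form (heis_d C) gamma.

Lemma tau_graded : graded_field 1 tau.
Proof.
have pG := psip_field_graded C; have mG := psim_field_graded C.
have cG := c_field_graded z1; have dG := d_field_graded z2.
apply: graded_fieldZ; apply: graded_fieldD; last exact/graded_fieldN/(deriv_graded pG).
apply: graded_fieldD; last exact/graded_fieldZ/(deriv_graded mG).
apply: graded_fieldD; apply: graded_fieldZ; first exact: (nop_graded _ cG pG).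
exact: (nop_graded _ dG mG).
Qed.

Lemma omega_graded : graded_field 2 omega.
Proof.
have pG := psip_field_graded C; have mG := psim_field_graded C.
have cG := c_field_graded z1; have dG := d_field_graded z2.
apply: graded_fieldD; last first.
  apply: graded_fieldZ; apply: graded_fieldD.
    exact: (nop_graded _ (deriv_graded pG) mG).
  exact: (nop_graded _ (deriv_graded mG) pG).
apply: graded_fieldD; last exact/graded_fieldN/graded_fieldZ/(deriv_graded dG).
apply: graded_fieldD; last exact/graded_fieldZ/(deriv_graded cG).
exact/graded_fieldZ/(nop_graded _ cG dG).
Qed.

Lemma fock_act_linear x : linear (act x).
Proof.
case: x => [n|n|n|n| | |] a u v /=.
- exact: omega_graded.1.
- by rewrite /alpha_field ((c_field_graded z1).1) scalerDr !scalerA mulrC.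
- exact: tau_graded.1.
- by rewrite /psi_field psim_linear scalerDr !scalerA mulrC.
- by rewrite scalerDr !scalerA mulrC.
- by rewrite scaler0 addr0.
- by rewrite scalerDr !scalerA mulrC.
Qed.

Lemma fock_act_degree x : has_degree (gen_degree x) (act x).
Proof.
case: x => [n|n|n|n| | |] /=.
- by have := omega_graded.2 (n + 1); congr (has_degree _ _); lia.
- have := has_degreeZ (a := - cLA) ((c_field_graded z1).2 n).
  by congr (has_degree _ _); lia.
- by have := tau_graded.2 (n + 1); congr (has_degree _ _); lia.
- have := has_degreeZ (a := - (q * cLA)) ((psim_field_graded C).2 n).
  by congr (has_degree _ _); lia.
- exact/has_degreeZ/has_degree_id.
- exact: has_degree0.
- exact/has_degreeZ/has_degree_id.
Qed.

Lemma vac_weight (k : state) : k \in msupp (fock_vac C) -> weight k = 0%N.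
Proof.
move=> /(fsubsetP msuppU_le); rewrite in_fset1 => /eqP ->.
by rewrite /weight !big_mset0 !big_seq_fset0.
Qed.

(** The vacuum has the lowest weight. *)
Lemma degree_vac (T : fock C -> fock C) e : has_degree e T -> e < 0 ->
  T (fock_vac C) = 0.
Proof.
move=> Te e0; apply/malgP => k; rewrite mcoeff0; apply/eqP; apply: contraT.
rewrite mcoeff_neq0 => /Te[k' /vac_weight ->]; lia.
Qed.

Lemma c_vac i : 0 < i -> c i (fock_vac C) = 0.
Proof. by move=> i0; apply: degree_vac ((c_field_graded z1).2 i) _; lia. Qed.

Lemma d_vac i : 0 < i -> d i (fock_vac C) = 0.
Proof. by move=> i0; apply: degree_vac ((d_field_graded z2).2 i) _; lia. Qed.

Lemma psip_vac i : 0 <= i -> psip i (fock_vac C) = 0.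
Proof. by move=> i0; apply: degree_vac ((psip_field_graded C).2 i) _; lia. Qed.

Lemma psim_vac i : 0 <= i -> psim i (fock_vac C) = 0.
Proof. by move=> i0; apply: degree_vac ((psim_field_graded C).2 i) _; lia. Qed.

Lemma lin_ext_scalar (z : C) u :
  lin_ext (fun k : state => << z *g k >> : fock C) u = z *: u.
Proof.
elim/malg_ind: u => [|a u v IHu IHv|k].
- by rewrite (lin0 (@lin_ext_linear _ _ _ _)) scaler0.
- by rewrite lin_ext_linear IHu IHv scalerDr !scalerA mulrC.
- by rewrite lin_extU scale1r malgZU mulr1.
Qed.

Lemma c_zero u : c 0 u = z1 *: u.
Proof. by rewrite c_fieldE; exact: lin_ext_scalar. Qed.

Lemma d_zero u : d 0 u = z2 *: u.
Proof. by rewrite d_fieldE; exact: lin_ext_scalar. Qed.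

(** An operator that supercommutes with the free fields is determined by its
    value on the vacuum, from which the creation operators generate everything.
    This value is annihilated by all annihilation operators, as the vacuum is,
    so it is a multiple of the vacuum; it vanishes if the operator shifts
    weights. *)
Lemma schur (T : fock C -> fock C) (e : C) (deg : int) : linear T ->
  (forall k u, c k (T u) = T (c k u)) -> (forall k u, d k (T u) = T (d k u)) ->
  (forall k u, psip k (T u) = e *: T (psip k u)) ->
  (forall k u, psim k (T u) = e *: T (psim k u)) ->
  e * e = 1 ->
  has_degree deg T -> (deg = 0 -> T (fock_vac C) = 0) ->
  forall u, T u = 0.
Proof.
move=> T_lin Tc Td Tp Tm ee Tdeg Tvac.
pose z (f : bool) := if f then z1 else z2.
have bE f n u : boson f (z f) n u = if f then c n u else d n u.
  by case: f; rewrite ?c_fieldE ?d_fieldE.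
have fE x b u : fermion x b u = if x.1 == b
    then psim (if b then Posz x.2 else Negz x.2) u
    else psip (if b then Posz x.2 else Negz x.2) u.
  by case: x b => [[] i] []; rewrite /= ?psimE ?psipE.
have T0 : T (fock_vac C) = 0.
  have TE : T (fock_vac C) = (T (fock_vac C))@_vac *: fock_vac C.
    apply: (annihilated_vac (z := z)) => [f i|x].
      rewrite bE; case: f; first by rewrite Tc c_vac // (lin0 T_lin).
      by rewrite Td d_vac // (lin0 T_lin).
    rewrite fE; case: ifP => _.
      by rewrite Tm psim_vac // (lin0 T_lin) scaler0.
    by rewrite Tp psip_vac // (lin0 T_lin) scaler0.
  have [vT|] := boolP (vac \in msupp (T (fock_vac C))); last first.
    by rewrite -mcoeff_eq0 => /eqP E; rewrite TE E scale0r.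
  have [k' /vac_weight -> vdeg] := Tdeg _ _ vT; apply: Tvac.
  have := @vac_weight vac; rewrite -mcoeff_neq0 mcoeffUU oner_neq0 => /(_ isT).
  by lia.
apply: (fock_ind (z := z)) => [//|a u v|f i u|x u].
- by move=> uE vE; rewrite T_lin uE vE scaler0 addr0.
- move=> uE; rewrite bE; case: f; first by rewrite -Tc uE (lin0 ((c_field_graded _).1 _)).
  by rewrite -Td uE (lin0 ((d_field_graded _).1 _)).
- move=> uE; rewrite fE; case: ifP => _.
    by rewrite -[LHS]scale1r -ee -scalerA -Tm uE (lin0 (psim_linear _)) scaler0.
  by rewrite -[LHS]scale1r -ee -scalerA -Tp uE (lin0 (psip_linear _)) scaler0.
Qed.

End Generators.

Section Transposition.
Variable V : zmodType.
Implicit Types a b x y : V.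

Lemma move_right a b x : a = b + x -> b = a - x.
Proof. by move=> ->; rewrite addrK. Qed.

Lemma move_right' a b x y : a = b + x + y -> b = a - x - y.
Proof. by move=> ->; rewrite addrAC addrK addrK. Qed.

Lemma odd_right a b x y : a = - b + x - y -> a = 0 -> b = x - y.
Proof.
by move=> -> /eqP; rewrite addrAC -addrA addrC addr_eq0 opprK [_ + x]addrC => /eqP.
Qed.

Lemma odd_right' a b x y : a = - b + x + y -> a = 0 -> b = x + y.
Proof. by rewrite -[y]opprK; exact: odd_right. Qed.

End Transposition.

Section Relations.
Variables (C : numClosedFieldType) (cL : C) (gamma : heis C).
Implicit Types (u : fock C) (n k i j : int).

Local Notation c := (c_field (heis_form (heis_c C) gamma)).
Local Notation d := (d_field (heis_form (heis_d C) gamma)).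
Local Notation psip := (@psip_field C).
Local Notation psim := (@psim_field C).
Local Notation tau := (tau_field cL gamma).
Local Notation omega := (omega_field cL gamma).
Local Notation q := (sqrtC (2 : C)).
Local Notation v := (fock_vac C).
Local Notation z1 := (heis_form (heis_c C) gamma).
Local Notation z2 := (heis_form (heis_d C) gamma).

Let qq : q * q = 2. Proof. by rewrite -expr2 sqrtCK. Qed.

Lemma nop_vac A B (a b : field C) (z : C) (m : nat) :
  graded_field A a -> graded_field B b ->
  (forall j, 0 < j -> a j v = 0) -> (forall j, 0 <= j -> b j v = 0) ->
  a 0 v = z *: v ->
  nop false a b (- m%:Z) v =
  z *: b (- m%:Z - 1) v + \sum_(j < m) a (- 1 - j%:Z) (b (- m%:Z + j%:Z) v).
Proof.
move=> aA bB av bv a0; have [N NE] := nop_finite false aA bB (- m%:Z) v.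
have a_lin k := aA.1 k; have b_lin k := bB.1 k.
rewrite (NE (m + N.+1)%N); last by lia.
rewrite big_split /= addrC; congr (_ + _).
  rewrite addnS big_ord_recl /= expr0 scale1r a0 (linZ (b_lin _)) subr0.
  by rewrite big1 ?addr0 // => j _; rewrite av // (lin0 (b_lin _)) scaler0.
rewrite big_split_ord /= [X in _ + X]big1 ?addr0 // => j _.
by rewrite bv ?(lin0 (a_lin _)) //; lia.
Qed.

Lemma omega_vac : omega 1 v = (2^-1 * (z1 * z2) - (cL - 3) / 24 * z1 + 2^-1 * z2) *: v.
Proof.
have pG := psip_field_graded C; have mG := psim_field_graded C.
have cG := c_field_graded z1; have dG := d_field_graded z2.
have E1 : nop false c d 1 v = (z1 * z2) *: v.
  have [N NE] := nop_finite false cG dG 1 v.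
  rewrite (NE N.+1) // big_ord_recl /= {1}/nop_term expr0 scale1r c_zero (linZ (dG.1 _)) subr0.
  rewrite subrr d_zero scalerA d_vac ?(lin0 (cG.1 _)) ?add0r //.
  rewrite big1 ?addr0 // => j _.
  by rewrite /nop_term d_vac ?c_vac ?(lin0 (cG.1 _)) ?(lin0 (dG.1 _)) ?scaler0 ?addr0.
have fer (a b : field C) : graded_field (-1) a -> graded_field (-1) b ->
    (forall j, 0 <= j -> a j v = 0) -> (forall j, 0 <= j -> b j v = 0) ->
    nop true (deriv_field a) b 1 v = 0.
  move=> aG bG av bv; have [N NE] := nop_finite true (deriv_graded aG) bG 1 v.
  rewrite (NE N) // big1 // => j _; rewrite /nop_term bv ?(lin0 ((deriv_graded aG).1 _)) //.
  rewrite /deriv_field add0r; case: (posnP j) => [->|j0].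
    by rewrite (_ : - _%:~R = 0); [rewrite scale0r (lin0 (bG.1 _)) scaler0|rewrite oppr0].
  by rewrite av ?scaler0 ?(lin0 (bG.1 _)) ?scaler0 //; lia.
have fer1 := fer _ _ pG mG (@psip_vac C) (@psim_vac C).
have fer2 := fer _ _ mG pG (@psim_vac C) (@psip_vac C).
have E2 : deriv_field c 1 v = - (z1 *: v).
  by rewrite /deriv_field subrr c_zero scaleN1r.
have E3 : deriv_field d 1 v = - (z2 *: v).
  by rewrite /deriv_field subrr d_zero scaleN1r.
have id_lin : linear (id : fock C -> fock C) by [].
apply: etrans (lin_omega _ _ _ _ id_lin E1 E2 E3 fer1 fer2) _.
by coef_goal; ring.
Qed.

Lemma sum_succ (m : nat) : \sum_(j < m) (j.+1%:R : C) = m%:R * (m%:R + 1) / 2.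
Proof.
elim: m => [|m IHm]; first by rewrite big_ord0 !mul0r.
by rewrite big_ord_recr /= IHm; field.
Qed.

(** The vector [tau (- m) v] is a combination of [c_(-1-j) Psi^+_(j-m) v] and
    [d_(-1-j) Psi^-_(j-m) v] with [j < m] and of linear terms.  Contracting
    [tau (m + 1)] with the boson leaves [sqrt 2 (j + 1)] times a contraction of
    two fermions, and the factors [j + 1] add up to [m (m + 1) / 2] for either
    family. *)
Lemma tau_tau_vac (m : nat) : tau (m%:Z + 1) (tau (- m%:Z) v) =
  (2 * (2^-1 * (z1 * z2) - (cL - 3) / 24 * z1 + 2^-1 * z2)
   + (m%:R ^+ 2 + m%:R) / 3 * cL) *: v.
Proof.
have pG := psip_field_graded C; have mG := psim_field_graded C.
have cG := c_field_graded z1; have dG := d_field_graded z2.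
have Gm : linear (tau (m%:Z + 1)) by exact: (tau_graded _ _).1.
have G0 : tau (m%:Z + 1) v = 0.
  by apply: degree_vac ((tau_graded cL gamma).2 (m%:Z + 1)) _; lia.
have tauc k u : tau (m%:Z + 1) (c k u) =
    c k (tau (m%:Z + 1) u) - (q * k%:~R) *: psim (m%:Z + k) u.
  exact: move_right (c_tau cL gamma k m%:Z u).
have taud k u : tau (m%:Z + 1) (d k u) =
    d k (tau (m%:Z + 1) u) - (q * k%:~R) *: psip (m%:Z + k) u.
  exact: move_right (d_tau cL gamma k m%:Z u).
have taup k : tau (m%:Z + 1) (psip k v) = (q / 2) *: d (m%:Z + k + 1) v
    - (q * (m%:Z + 1)%:~R * ((cL - 3) / 12) * (m%:Z + k + 1 == 0)%:R) *: v.
  by apply: odd_right (psip_tau cL gamma k m%:Z v) _; rewrite G0 (lin0 (pG.1 _)).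
have taum k : tau (m%:Z + 1) (psim k v) = (q / 2) *: c (m%:Z + k + 1) v
    + (q * (m%:Z + 1)%:~R * (m%:Z + k + 1 == 0)%:R) *: v.
  by apply: odd_right' (psim_tau cL gamma k m%:Z v) _; rewrite G0 (lin0 (mG.1 _)).
have sumE (F : 'I_m -> fock C) :
    (forall j : 'I_m, tau (m%:Z + 1) (F j) = (q * j.+1%:R) *: v) ->
    tau (m%:Z + 1) (\sum_(j < m) F j) = (q * (m%:R * (m%:R + 1) / 2)) *: v.
  move=> FE; rewrite (lin_sum Gm) (eq_bigr _ (fun (j : 'I_m) _ => FE j)) -scaler_suml.
  by rewrite -mulr_sumr sum_succ.
have F1 : tau (m%:Z + 1) (nop false c psip (- m%:Z) v) =
    (z1 * (q / 2 * z2 - q * (m%:R + 1) * ((cL - 3) / 12))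
     + q * (m%:R * (m%:R + 1) / 2)) *: v.
  rewrite (nop_vac (z := z1) _ cG pG) => [|j|j|]; last 3 first.
  - exact: c_vac.
  - exact: psip_vac.
  - exact: c_zero.
  rewrite (linD Gm) (linZ Gm) taup sumE => [|j]; last first.
    have jm := ltn_ord j.
    rewrite tauc taup d_vac ?scaler0; last by lia.
    rewrite (_ : (_ == 0) = false); last by lia.
    rewrite mulr0 scale0r subr0 (lin0 (cG.1 _)) psimp psim_vac; last by lia.
    rewrite (lin0 (pG.1 _)) (_ : (_ == 0) = true); last by lia.
    by rewrite mulr1n; coef_goal; ring.
  rewrite (_ : m%:Z + _ + 1 = 0); last by lia.
  by rewrite d_zero eqxx mulr1n; coef_goal; field.
have F2 : tau (m%:Z + 1) (nop false d psim (- m%:Z) v) =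
    (z2 * (q / 2 * z1 + q * (m%:R + 1)) + q * (m%:R * (m%:R + 1) / 2)) *: v.
  rewrite (nop_vac (z := z2) _ dG mG) => [|j|j|]; last 3 first.
  - exact: d_vac.
  - exact: psim_vac.
  - exact: d_zero.
  rewrite (linD Gm) (linZ Gm) taum sumE => [|j]; last first.
    have jm := ltn_ord j.
    rewrite taud taum c_vac ?scaler0; last by lia.
    rewrite (_ : (_ == 0) = false); last by lia.
    rewrite mulr0 scale0r addr0 (lin0 (dG.1 _)) psipm psip_vac; last by lia.
    rewrite (lin0 (mG.1 _)) (_ : (_ == 0) = true); last by lia.
    by rewrite mulr1n; coef_goal; ring.
  rewrite (_ : m%:Z + _ + 1 = 0); last by lia.
  by rewrite c_zero eqxx mulr1n; coef_goal; field.
have F3 : tau (m%:Z + 1) (deriv_field psim (- m%:Z) v) =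
    (m%:R * (q / 2 * z1 + q * (m%:R + 1))) *: v.
  rewrite /deriv_field (linZ Gm) taum (_ : m%:Z + _ + 1 = 0); last by lia.
  by rewrite c_zero eqxx mulr1n; coef_goal; ring.
have F4 : tau (m%:Z + 1) (deriv_field psip (- m%:Z) v) =
    (m%:R * (q / 2 * z2 - q * (m%:R + 1) * ((cL - 3) / 12))) *: v.
  rewrite /deriv_field (linZ Gm) taup (_ : m%:Z + _ + 1 = 0); last by lia.
  by rewrite d_zero eqxx mulr1n; coef_goal; ring.
rewrite {2}/tau_field (lin_tau _ _ _ _ Gm F1 F2 F3 F4).
by coef_goal; field: qq.
Qed.

End Relations.

Section SuperalgebraAction.
Variables (C : numClosedFieldType) (cL : C) (gamma : heis C).
Implicit Types (u : fock C) (n k i j : int).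

Local Notation c := (c_field (heis_form (heis_c C) gamma)).
Local Notation d := (d_field (heis_form (heis_d C) gamma)).
Local Notation psip := (@psip_field C).
Local Notation psim := (@psim_field C).
Local Notation q := (sqrtC (2 : C)).
Local Notation v := (fock_vac C).

Definition tau_mode i : fock C -> fock C := tau_field cL gamma (i + 1).
Definition omega_mode i : fock C -> fock C := omega_field cL gamma (i + 1).

Let G := tau_mode.
Let L := omega_mode.

Let G_lin i : linear (G i). Proof. exact: (tau_graded _ _).1. Qed.
Let L_lin i : linear (L i). Proof. exact: (omega_graded _ _).1. Qed.
Let G_deg i : has_degree (- (2 * i + 1)) (G i).
Proof. exact (@fock_act_degree C cL 0 gamma (gG i)). Qed.
Let L_deg i : has_degree (- (2 * i)) (L i).
Proof. exact (@fock_act_degree C cL 0 gamma (gL i)). Qed.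

Lemma defect_GG_degree i j :
  has_degree (- (2 * (i + j + 1))) (defect_GG cL G L i j).
Proof.
have GG k l : has_degree (- (2 * (k + l + 1))) (fun u => G k (G l u)).
  by have := has_degree_comp (@G_deg k) (@G_deg l); congr (has_degree _ _); lia.
apply: has_degreeD; last first.
  case: eqP => [->|_]; apply: has_degreeN; first exact/has_degreeZ/has_degree_id.
  by move=> u l; rewrite !mul0r scale0r msupp0.
apply: has_degreeD; last exact/has_degreeN/has_degreeZ/L_deg.
apply: has_degreeD; first exact: GG.
by have := GG j i; congr (has_degree _ _); lia.
Qed.

Lemma defect_LG_degree i j :
  has_degree (- (2 * (i + j) + 1)) (defect_LG G L i j).
Proof.
apply: has_degreeD; last exact/has_degreeN/has_degreeZ/G_deg.
apply: has_degreeD; last apply: has_degreeN.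
  by have := has_degree_comp (@L_deg i) (@G_deg j); congr (has_degree _ _); lia.
by have := has_degree_comp (@G_deg j) (@L_deg i); congr (has_degree _ _); lia.
Qed.

Lemma defect_GG_vac (m : nat) : defect_GG cL G L m%:Z (- m%:Z - 1) v = 0.
Proof.
have G0 : tau_field cL gamma (m%:Z + 1) v = 0.
  by apply: degree_vac ((tau_graded cL gamma).2 (m%:Z + 1)) _; lia.
rewrite /defect_GG /G /L /tau_mode /omega_mode G0 (lin0 ((tau_graded _ _).1 _)).
rewrite subrK tau_tau_vac (_ : m%:Z + _ + 1 = 0); last by lia.
rewrite add0r omega_vac eqxx mulr1n.
by coef_goal; field.
Qed.

Lemma defect_GG_sym i j u : defect_GG cL G L i j u = defect_GG cL G L j i u.
Proof.
rewrite /defect_GG (_ : j + i + 1 = i + j + 1); last by lia.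
case: eqP => [E|_]; last by rewrite !mulr0n !mul0r; coef_goal; ring.
by rewrite (_ : j = - i - 1); [coef_goal; ring|lia].
Qed.

Let c_lin k : linear (c k). Proof. exact: (c_field_graded _).1. Qed.
Let d_lin k : linear (d k). Proof. exact: (d_field_graded _).1. Qed.
Let p_lin := @psip_linear C.
Let m_lin := @psim_linear C.

Let cG k i u : c k (G i u) = G i (c k u) + (q * k%:~R) *: psim (i + k) u :=
  c_tau cL gamma k i u.
Let dG k i u : d k (G i u) = G i (d k u) + (q * k%:~R) *: psip (i + k) u :=
  d_tau cL gamma k i u.
Let pG k i u : psip k (G i u) = - G i (psip k u) + (q / 2) *: d (i + k + 1) u
    - (q * (i + 1)%:~R * ((cL - 3) / 12) * (i + k + 1 == 0)%:R) *: u :=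
  psip_tau cL gamma k i u.
Let mG k i u : psim k (G i u) = - G i (psim k u) + (q / 2) *: c (i + k + 1) u
    + (q * (i + 1)%:~R * (i + k + 1 == 0)%:R) *: u :=
  psim_tau cL gamma k i u.
Let cLc k i u : c k (L i u) = L i (c k u) + k%:~R *: c (i + k) u
    + (k%:~R * (i + 1)%:~R * (i + k == 0)%:R) *: u :=
  c_omega cL gamma k i u.
Let dLd k i u : d k (L i u) = L i (d k u) + k%:~R *: d (i + k) u
    - ((cL - 3) / 12 * k%:~R * (i + 1)%:~R * (i + k == 0)%:R) *: u :=
  d_omega cL gamma k i u.
Let pL k i u : psip k (L i u) =
    L i (psip k u) + (k%:~R + (i + 1)%:~R / 2) *: psip (i + k) u :=
  psip_omega cL gamma k i u.
Let mL k i u : psim k (L i u) =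
    L i (psim k u) + (k%:~R + (i + 1)%:~R / 2) *: psim (i + k) u :=
  psim_omega cL gamma k i u.

Lemma comm_GG i j u : defect_GG cL G L i j u = 0.
Proof.
apply: (@schur C gamma (defect_GG cL G L i j) 1 (- (2 * (i + j + 1)))).
- exact: defect_GG_linear.
- by move=> k w; exact (c_defect_GG cL c_lin G_lin cG mG cLc k i j w).
- by move=> k w; exact (d_defect_GG d_lin G_lin dG pG dLd k i j w).
- by move=> k w; exact (p_defect_GG p_lin G_lin dG pG pL k i j w).
- by move=> k w; exact (m_defect_GG cL m_lin G_lin cG mG mL k i j w).
- exact: mulr1.
- exact: defect_GG_degree.
- case: i => [m|m] ij.
    by rewrite (_ : j = - m%:Z - 1); [exact: defect_GG_vac|lia].
  rewrite defect_GG_sym (_ : j = m%:Z); last by lia.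
  by rewrite (_ : Negz m = - m%:Z - 1); [exact: defect_GG_vac|lia].
Qed.

Lemma comm_LG i j u : defect_LG G L i j u = 0.
Proof.
apply: (@schur C gamma (defect_LG G L i j) (- 1) (- (2 * (i + j) + 1))).
- exact: defect_LG_linear.
- by move=> k w; exact (c_defect_LG c_lin G_lin L_lin cG cLc mL k i j w).
- by move=> k w; exact (d_defect_LG d_lin G_lin L_lin dG dLd pL k i j w).
- by move=> k w; exact (p_defect_LG p_lin G_lin L_lin pG dLd pL k i j w).
- by move=> k w; exact (m_defect_LG m_lin G_lin L_lin mG cLc mL k i j w).
- by rewrite mulN1r opprK.
- exact: defect_LG_degree.
- by lia.
Qed.

Lemma GG_comm i j u : G i (G j u) = - G j (G i u) + 2 *: L (i + j + 1) u
  + ((i + j + 1 == 0)%:R * ((i ^+ 2 + i)%:~R / 3) * cL) *: u.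
Proof.
apply/eqP; rewrite -subr_eq0 -[X in _ == X](comm_GG i j u); apply/eqP.
by rewrite /defect_GG; coef_goal; ring.
Qed.

Lemma LG_comm i j u : L i (G j u) =
  G j (L i u) + (i%:~R / 2 - j%:~R - 1 / 2) *: G (i + j) u.
Proof.
apply/eqP; rewrite -subr_eq0 -[X in _ == X](comm_LG i j u); apply/eqP.
by rewrite /defect_LG; coef_goal; ring.
Qed.

Lemma LL_comm i j u : L i (L j u) = L j (L i u) + (i - j)%:~R *: L (i + j) u
  + ((i + j == 0)%:R * ((i ^+ 3 - i)%:~R / 12) * cL) *: u.
Proof. exact (LL_of_GG_LG G_lin L_lin GG_comm LG_comm i j u). Qed.

End SuperalgebraAction.

Section Brackets.
Variables (C : numClosedFieldType) (cL cLA : C) (gamma : heis C).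
Implicit Types (u : fock C) (m n : int) (x y : gen).

Local Notation c := (c_field (heis_form (heis_c C) gamma)).
Local Notation psim := (@psim_field C).
Local Notation q := (sqrtC (2 : C)).
Local Notation act := (fock_act cL cLA gamma).
Local Notation G := (tau_mode cL gamma).
Local Notation L := (omega_mode cL gamma).

Definition brackets_to x y (b : seq (C * gen)) : Prop := forall u,
  act x (act y u) - swap_sign C x y *: act y (act x u)
  = \sum_(t <- b) t.1 *: act t.2 u.

Lemma even_bracket x y b :
  odd_gen x && odd_gen y = false ->
  (forall u, act x (act y u) = act y (act x u) + \sum_(t <- b) t.1 *: act t.2 u) ->
  brackets_to x y b.
Proof.
by move=> xy E u; rewrite E /swap_sign xy expr0 scale1r addrC addKr.
Qed.

Lemma odd_bracket x y b :
  odd_gen x && odd_gen y = true ->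
  (forall u, act x (act y u) = - act y (act x u) + \sum_(t <- b) t.1 *: act t.2 u) ->
  brackets_to x y b.
Proof.
by move=> xy E u; rewrite E /swap_sign xy expr1 scaleN1r opprK addrC addNKr.
Qed.

Lemma sum1 (a : C) x u : \sum_(t <- [:: (a, x)]) t.1 *: act t.2 u = a *: act x u.
Proof. by rewrite big_seq1. Qed.

Lemma sum2 (a b : C) x y u : \sum_(t <- [:: (a, x); (b, y)]) t.1 *: act t.2 u =
  a *: act x u + b *: act y u.
Proof. by rewrite big_cons big_seq1. Qed.

Let qq : q * q = 2. Proof. by rewrite -expr2 sqrtCK. Qed.

Lemma bracket_LL m n u : act (gL m) (act (gL n) u) = act (gL n) (act (gL m) u)
  + ((m - n)%:~R *: act (gL (m + n)) u
     + ((m + n == 0)%:R * ((m ^+ 3 - m)%:~R / 12)) *: act gCL u).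
Proof.
by apply: etrans (LL_comm cL gamma m n u) _; rewrite -addrA [_ *: act gCL u]scalerA.
Qed.

Lemma bracket_LG m n u : act (gL m) (act (gG n) u) = act (gG n) (act (gL m) u)
  + (m%:~R / 2 - n%:~R - 1 / 2) *: act (gG (m + n)) u.
Proof. exact: LG_comm. Qed.

Lemma bracket_GG m n u : act (gG m) (act (gG n) u) = - act (gG n) (act (gG m) u)
  + (2 *: act (gL (m + n + 1)) u
     + ((m + n + 1 == 0)%:R * ((m ^+ 2 + m)%:~R / 3)) *: act gCL u).
Proof.
by apply: etrans (GG_comm cL gamma m n u) _; rewrite -addrA [_ *: act gCL u]scalerA.
Qed.

Lemma bracket_LA m n u : act (gL m) (act (gAlpha n) u) =
  act (gAlpha n) (act (gL m) u)
  + (- n%:~R *: act (gAlpha (m + n)) u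
     + - ((m + n == 0)%:R * (m ^+ 2 + m)%:~R) *: act gCLAlpha u).
Proof.
apply: etrans (linZ ((omega_graded cL gamma).1 _) _ _) _.
rewrite (move_right' (c_omega cL gamma n m u)).
change (act (gAlpha n) (act (gL m) u))
  with (- cLA *: c n (omega_field cL gamma (m + 1) u)).
change (act (gAlpha (m + n)) u) with (- cLA *: c (m + n) u).
change (act gCLAlpha u) with (cLA *: u).
case: eqP => [E|_]; last by rewrite !mulr0n; coef_goal; ring.
by rewrite mulr1n (_ : n = - m); [coef_goal; ring|lia].
Qed.

Lemma bracket_AA m n u : act (gAlpha m) (act (gAlpha n) u) =
  act (gAlpha n) (act (gAlpha m) u)
  + ((m + n == 0)%:R * m%:~R) *: act gCAlpha u.
Proof.
rewrite [_ *: act gCAlpha u]scaler0 addr0.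
apply: etrans (congr1 _ (linZ ((c_field_graded _).1 _) _ _)) _.
apply: esym; apply: etrans (congr1 _ (linZ ((c_field_graded _).1 _) _ _)) _.
by rewrite cc_comm.
Qed.

Lemma bracket_PP m n u : act (gPsi m) (act (gPsi n) u) =
  - act (gPsi n) (act (gPsi m) u) + (m + n + 1 == 0)%:R *: act gCAlpha u.
Proof.
rewrite [_ *: act gCAlpha u]scaler0 addr0.
apply: etrans (congr1 _ (linZ (psim_linear _) _ _)) _.
rewrite psimm !scalerN; congr (- _).
by apply: esym; apply: etrans (congr1 _ (linZ (psim_linear _) _ _)) _.
Qed.

Lemma bracket_AP m n u : act (gAlpha m) (act (gPsi n) u) = act (gPsi n) (act (gAlpha m) u).
Proof.
apply: etrans (congr1 _ (linZ ((c_field_graded _).1 _) _ _)) _.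
apply: esym; apply: etrans (congr1 _ (linZ (psim_linear _) _ _)) _.
by rewrite cm_comm !scalerA mulrC.
Qed.

Lemma bracket_AG m n u : act (gAlpha m) (act (gG n) u) = act (gG n) (act (gAlpha m) u)
  + m%:~R *: act (gPsi (m + n)) u.
Proof.
apply: etrans (congr1 _ (c_tau cL gamma m n u)) _.
apply: esym.
apply: etrans (congr1 (fun w => w + _) (linZ ((tau_graded cL gamma).1 _) _ _)) _; cbv beta.
change (act (gPsi (m + n)) u) with (- (q * cLA) *: psim (m + n) u).
by rewrite (_ : m + n = n + m); [coef_goal; ring|lia].
Qed.

Lemma bracket_PL m n u : act (gPsi m) (act (gL n) u) = act (gL n) (act (gPsi m) u)
  + ((2 * m + n + 1)%:~R / 2) *: act (gPsi (m + n)) u.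
Proof.
apply: etrans (congr1 _ (psim_omega cL gamma m n u)) _.
apply: esym.
apply: etrans (congr1 (fun w => w + _) (linZ ((omega_graded cL gamma).1 _) _ _)) _; cbv beta.
change (act (gPsi (m + n)) u) with (- (q * cLA) *: psim (m + n) u).
by rewrite (_ : m + n = n + m); [coef_goal; field|lia].
Qed.

Lemma bracket_PG m n u : act (gPsi m) (act (gG n) u) = - act (gG n) (act (gPsi m) u)
  + (1 *: act (gAlpha (m + n + 1)) u
     + (2 * m%:~R * (m + n + 1 == 0)%:R) *: act gCLAlpha u).
Proof.
apply: etrans (congr1 _ (psim_tau cL gamma m n u)) _.
apply: esym.
apply: etrans (congr1 (fun w => - w + _) (linZ ((tau_graded cL gamma).1 _) _ _)) _; cbv beta.
change (act (gAlpha (m + n + 1)) u) with (- cLA *: c (m + n + 1) u).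
change (act gCLAlpha u) with (cLA *: u).
rewrite (_ : n + m = m + n); last by lia.
case: eqP => [E|_]; last by rewrite !mulr0n; coef_goal; field: qq.
by rewrite mulr1n (_ : n = - m - 1); [coef_goal; field: qq|lia].
Qed.

Lemma listed_bracketP x y b : listed_bracket C x y = Some b -> brackets_to x y b.
Proof.
case: x y => [m|m|m|m| | |] [n|n|n|n| | |] // [<-].
- by apply: even_bracket => // u; rewrite sum2; exact: bracket_LL.
- by apply: even_bracket => // u; rewrite sum2; exact: bracket_LA.
- by apply: even_bracket => // u; rewrite sum1; exact: bracket_LG.
- by apply: even_bracket => // u; rewrite sum1; exact: bracket_AA.
- by apply: even_bracket => // u; rewrite sum1; exact: bracket_AG.
- by apply: even_bracket => // u; rewrite big_nil addr0; exact: bracket_AP.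
- by apply: odd_bracket => // u; rewrite sum2; exact: bracket_GG.
- by apply: even_bracket => // u; rewrite sum1; exact: bracket_PL.
- by apply: odd_bracket => // u; rewrite sum2; exact: bracket_PG.
- by apply: odd_bracket => // u; rewrite sum1; exact: bracket_PP.
Qed.

(** The brackets that are not listed follow by super skew-symmetry, or involve
    a central element, which acts by a scalar. *)
Lemma fock_brackets x y : brackets_to x y (sh_bracket C x y).
Proof.
have act_lin := fock_act_linear cL cLA gamma.
rewrite /sh_bracket; case Exy: (listed_bracket C x y) => [b|].
  exact: listed_bracketP.
case Eyx: (listed_bracket C y x) => [b|] u.
  have E := listed_bracketP Eyx u; rewrite big_map.
  rewrite (eq_bigr (fun t => - swap_sign C x y *: (t.1 *: act t.2 u))); last first.
    by move=> t _; rewrite scalerA mulNr.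
  rewrite -scaler_sumr -E.
  rewrite (_ : swap_sign C y x = swap_sign C x y); last by rewrite /swap_sign andbC.
  have ss : swap_sign C x y * swap_sign C x y = 1 by rewrite -expr2 sqrr_sign.
  by coef_goal; ring: ss.
rewrite big_nil.
have scal z : (forall w, act x w = z *: w) \/ (forall w, act y w = z *: w) ->
    odd_gen x && odd_gen y = false ->
    act x (act y u) - swap_sign C x y *: act y (act x u) = 0.
  rewrite /swap_sign => + -> /=; rewrite expr0 scale1r => -[] E.
    by rewrite !E (linZ (act_lin _)) subrr.
  by rewrite !E (linZ (act_lin _)) subrr.
by case: x y Exy Eyx scal => [m|m|m|m| | |] [n|n|n|n| | |] // _ _ scal;
  first [ apply: (scal cL); [by left|by []] | apply: (scal cL); [by right|by []]
  | apply: (scal cLA); [by left|by []] | apply: (scal cLA); [by right|by []]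
  | apply: (scal 0); [by left => w; rewrite scale0r|by []]
  | apply: (scal 0); [by right => w; rewrite scale0r|by []] ].
Qed.

End Brackets.

(** * Singular vectors *)

Section SingularVectors.
Variables (C : numClosedFieldType) (cL : C) (gamma : heis C) (x : fock C).
Implicit Types (u : fock C) (n i j : int).

Local Notation c := (c_field (heis_form (heis_c C) gamma)).
Local Notation d := (d_field (heis_form (heis_d C) gamma)).
Local Notation psip := (@psip_field C).
Local Notation psim := (@psim_field C).
Local Notation tau := (tau_field cL gamma).
Local Notation omega := (omega_field cL gamma).
Local Notation q := (sqrtC (2 : C)).
Local Notation z1 := (heis_form (heis_c C) gamma).
Local Notation z2 := (heis_form (heis_d C) gamma).

Let cG := c_field_graded z1.
Let dG := d_field_graded z2.
Let pG := psip_field_graded C.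
Let mG := psim_field_graded C.

Hypothesis z1P : forall n : nat, z1 + n.+2%:R != 0.
Hypothesis cx : forall i, 0 < i -> c i x = 0.
Hypothesis mx : forall i, 0 <= i -> psim i x = 0.

Lemma nop_first A B (a b : field C) n (z : C) :
  graded_field A a -> graded_field B b ->
  (forall j : nat, b (n + j%:Z) x = 0) ->
  (forall j : nat, b (n - 1 - j.+1%:Z) (a j.+1%:Z x) = 0) ->
  a 0 x = z *: x -> nop false a b n x = z *: b (n - 1) x.
Proof.
move=> aA bB bx abx a0; have [N NE] := nop_finite false aA bB n x.
have a_lin k := aA.1 k; have b_lin k := bB.1 k.
have bx0 := bx 0%N.
rewrite (NE N.+1) // big_ord_recl /= {1}/nop_term expr0 scale1r a0 bx0.
rewrite (lin0 (a_lin _)) add0r subr0 (linZ (b_lin _)) big1 ?addr0 // => j _.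
by rewrite /nop_term bx abx (lin0 (a_lin _)) scaler0 addr0.
Qed.

Lemma nop_none A B (a b : field C) n :
  graded_field A a -> graded_field B b ->
  (forall j : nat, b (n + j%:Z) x = 0) ->
  (forall j : nat, b (n - 1 - j%:Z) (a j%:Z x) = 0) ->
  nop true a b n x = 0.
Proof.
move=> aA bB bx abx; have [N NE] := nop_finite true aA bB n x.
rewrite (NE N) // big1 // => j _.
by rewrite /nop_term bx abx (lin0 (aA.1 _)) scaler0 addr0.
Qed.

(** On a vector killed by the positive modes of c and Psi^-, the mode [L(n+1)]
    acts as a nonzero multiple of [d(n+1)] up to modes of higher index. *)
Lemma omega_leading (n : nat) :
  (forall i, n%:Z + 1 < i -> d i x = 0) -> (forall i, n%:Z < i -> psip i x = 0) ->
  omega (n%:Z + 2) x = (2^-1 * (z1 + n.+2%:R)) *: d (n%:Z + 1) x.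
Proof.
move=> dx px.
have E1 : nop false c d (n%:Z + 2) x = z1 *: d (n%:Z + 1) x.
  rewrite (nop_first (z := z1) cG dG) => [|j|j|].
  - by rewrite (_ : n%:Z + 2 - 1 = n%:Z + 1) //; lia.
  - by apply: dx; lia.
  - by rewrite cx // (lin0 (dG.1 _)).
  - exact: c_zero.
have E2 : deriv_field c (n%:Z + 2) x = 0.
  by rewrite /deriv_field cx ?scaler0 //; lia.
have E3 : deriv_field d (n%:Z + 2) x = - n.+2%:R *: d (n%:Z + 1) x.
  rewrite /deriv_field (_ : n%:Z + 2 - 1 = n%:Z + 1); last by lia.
  by coef_goal; ring.
have E4 : nop true (deriv_field psip) psim (n%:Z + 2) x = 0.
  apply: nop_none (deriv_graded pG) mG _ _ => j; first by apply: mx; lia.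
  rewrite /deriv_field (linZ (mG.1 _)); case: j => [|j].
    by rewrite (_ : - _%:~R = 0); [rewrite scale0r|rewrite oppr0].
  have [nj|jn] := ltnP n j; first by rewrite px ?(lin0 (mG.1 _)) ?scaler0 //; lia.
  rewrite psimp mx; last by lia.
  rewrite (lin0 (pG.1 _)) (_ : (_ == 0) = false); last by lia.
  by rewrite mulr0n scale0r oppr0 addr0 scaler0.
have E5 : nop true (deriv_field psim) psip (n%:Z + 2) x = 0.
  apply: nop_none (deriv_graded mG) pG _ _ => j; first by apply: px; lia.
  rewrite /deriv_field (linZ (pG.1 _)); case: j => [|j].
    by rewrite (_ : - _%:~R = 0); [rewrite scale0r|rewrite oppr0].
  by rewrite mx ?(lin0 (pG.1 _)) ?scaler0 //; lia.
have id_lin : linear (id : fock C -> fock C) by [].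
apply: etrans (lin_omega _ _ _ _ id_lin E1 E2 E3 E4 E5) _.
by coef_goal; ring.
Qed.

(** Likewise [G(n+1/2)] acts as a nonzero multiple of [Psi^+(n+1/2)] up to modes
    of higher index. *)
Lemma tau_leading (n : nat) :
  (forall i, n%:Z < i -> d i x = 0) -> (forall i, n%:Z < i -> psip i x = 0) ->
  tau (n%:Z + 1) x = (q * (2^-1 * z1 + n.+1%:R)) *: psip n%:Z x.
Proof.
move=> dx px.
have E1 : nop false c psip (n%:Z + 1) x = z1 *: psip n%:Z x.
  rewrite (nop_first (z := z1) cG pG) => [|j|j|].
  - by rewrite addrK.
  - by apply: px; lia.
  - by rewrite cx // (lin0 (pG.1 _)).
  - exact: c_zero.
have E2 : nop false d psim (n%:Z + 1) x = 0.
  rewrite (nop_first (z := z2) dG mG) => [|j|j|].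
  - by rewrite mx ?scaler0 //; lia.
  - by apply: mx; lia.
  - have [jn|nj] := ltnP j n; last by rewrite dx ?(lin0 (mG.1 _)) //; lia.
    by rewrite -dm_comm mx ?(lin0 (dG.1 _)) //; lia.
  - exact: d_zero.
have E3 : deriv_field psim (n%:Z + 1) x = 0.
  by rewrite /deriv_field mx ?scaler0 //; lia.
have E4 : deriv_field psip (n%:Z + 1) x = - n.+1%:R *: psip n%:Z x.
  by rewrite /deriv_field addrK; coef_goal; ring.
have id_lin : linear (id : fock C -> fock C) by [].
apply: etrans (lin_tau _ _ _ _ id_lin E1 E2 E3 E4) _.
by coef_goal; ring.
Qed.

Hypothesis Gx : forall i, 0 <= i -> tau (i + 1) x = 0.
Hypothesis Lx : forall i, 1 <= i -> omega (i + 1) x = 0.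

Lemma scaler_cancel (a : C) u : a != 0 -> a *: u = 0 -> u = 0.
Proof. by move=> a0 au; rewrite -[u]scale1r -(mulVf a0) -scalerA au scaler0. Qed.

(** Descending induction on the index: [L(n+1) x = 0] forces [d(n+1) x = 0], and
    then [G(n+1/2) x = 0] forces [Psi^+(n+1/2) x = 0]. *)
Lemma singular_annihilated (n : nat) :
  (forall i, n%:Z < i -> d i x = 0) /\ (forall i, n%:Z <= i -> psip i x = 0).
Proof.
have [N1 dN] := graded_vanish x dG; have [N2 pN] := graded_vanish x pG.
have [N le_nN] : exists N : nat, (n <= N)%N /\ (N1 + N2 <= N)%N.
  by exists (n + N1 + N2)%N; lia.
rewrite -(subKn le_nN.1); elim: (N - n)%N => [|k IHk].
  by rewrite subn0; split=> i Ni; [apply: dN|apply: pN]; lia.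
have [kN|Nk] := ltnP k N; last by move: IHk; rewrite (_ : N - k.+1 = N - k)%N //; lia.
set m := (N - k.+1)%N; have mE : (N - k)%N = m.+1 by rewrite /m; lia.
rewrite mE in IHk; case: IHk => dk pk.
have d0 : d (m%:Z + 1) x = 0.
  have := Lx (i := m%:Z + 1); rewrite -addrA omega_leading; last 2 first.
  - by move=> i mi; apply: dk; lia.
  - by move=> i mi; apply: pk; lia.
  move=> /(_ _) E; apply: scaler_cancel (E _); last by lia.
  by rewrite mulf_neq0 ?z1P // invr_eq0 pnatr_eq0.
have dm i : m%:Z < i -> d i x = 0.
  move=> mi; have [->//|ne] := eqVneq i (m%:Z + 1); apply: dk; lia.
split=> // i mi; have [->|ne] := eqVneq i m%:Z; last by apply: pk; lia.
have := Gx (i := m%:Z); rewrite tau_leading; last 2 first.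
- exact: dm.
- by move=> j mj; apply: pk; lia.
move=> /(_ _) E; apply: scaler_cancel (E _); last by lia.
rewrite mulf_neq0 //; first by rewrite sqrtC_eq0 pnatr_eq0.
have := z1P m.*2; apply: contra_neq => E0.
have -> : z1 + m.*2.+2%:R = 2 * (2^-1 * z1 + m.+1%:R) by rewrite -addnn; field.
by rewrite E0 mulr0.
Qed.

Lemma singular_vac : x = x@_vac *: fock_vac C.
Proof.
have [dx px] := singular_annihilated 0.
apply: (annihilated_vac (z := fun f => if f then z1 else z2)) => [[] i|[[] i]].
- by rewrite -c_fieldE cx.
- by rewrite -d_fieldE dx.
- by have := mx (i := i); rewrite psimE; exact.
- by have := px i; rewrite psipE; exact.
Qed.

End SingularVectors.

(** * Every submodule contains the highest weight vector *)

Section Socle.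
Variables (C : numClosedFieldType) (cL cLA : C) (gamma : heis C).
Hypothesis cLA_neq0 : cLA != 0.
Hypothesis z1P : forall n : nat, heis_form (heis_c C) gamma + n.+2%:R != 0.

Local Notation act := (fock_act cL cLA gamma).

Lemma singular_multiple (x : fock C) :
  (forall g, positive_gen g -> act g x = 0) -> x = x@_vac *: fock_vac C.
Proof.
move=> x_sing; apply: (@singular_vac C cL gamma x z1P).
- move=> i i0; have cLA0 : - cLA != 0 by rewrite oppr_eq0.
  by apply: (scaler_cancel cLA0); exact: (x_sing (gAlpha i)).
- move=> i i0; have a0 : - (sqrtC 2 * cLA) != 0.
    by rewrite oppr_eq0 mulf_neq0 // sqrtC_eq0 pnatr_eq0.
  by apply: (scaler_cancel a0); exact: (x_sing (gPsi i)).
- by move=> i i0; exact: (x_sing (gG i)).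
- by move=> i i0; exact: (x_sing (gL i)).
Qed.

(** Positive generators lower the weight, so applying them to a nonzero vector
    as long as possible ends in a nonzero singular vector. *)
Lemma submodule_vac (N : set (fock C)) (x : fock C) :
  submodule act N -> N x -> x <> 0 -> N (fock_vac C).
Proof.
move=> [N0 ND Nact]; have [n] : exists n, forall k, k \in msupp x -> (weight k < n)%N.
  exists (\sum_(k <- msupp x) weight k).+1 => k xk.
  by rewrite ltnS (big_fsetD1 k) //= leq_addr.
elim: n x => [|n IHn] x xn Nx x0.
  exfalso; apply: x0; apply/malgP => k; rewrite mcoeff0; apply/eqP.
  by apply: contraT; rewrite mcoeff_neq0 => /xn.
have [[g [g_pos gx]]|none] := pselect (exists g, positive_gen g /\ act g x <> 0).
  apply: (IHn (act g x)) gx; last exact: Nact.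
  move=> k /(fock_act_degree (x := g))[k' /xn k'n kE].
  by move: g_pos; rewrite positive_genE; lia.
have xE : x = x@_vac *: fock_vac C.
  apply: singular_multiple => g g_pos; apply: contrapT => gx; apply: none.
  by exists g.
have a0 : x@_vac != 0 by apply/eqP => a0; apply: x0; rewrite xE a0 scale0r.
rewrite -[fock_vac C]scale1r -(mulVf a0) -scalerA -xE -[_ *: x]addr0.
exact: ND.
Qed.

Lemma cyclic_vac (x : fock C) : x != 0 -> cyclic_submodule act x (fock_vac C).
Proof. by move=> /eqP x0 N [Nsub Nx]; apply: submodule_vac Nsub _ x0; apply: Nx. Qed.

End Socle.

(** * Quotients of modules and the simple highest weight module *)

Section QuotientLift.
Variables (C : nzRingType) (X : Type) (V W : lmodType C).
Variables (act : X -> V -> V) (actW : X -> W -> W) (G : set V) (g : V -> W).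
Hypotheses (act_lin : forall x, linear (act x)).
Hypotheses (actW_lin : forall x, linear (actW x)) (g_lin : linear g).
Hypothesis g_act : forall x u, g (act x u) = actW x (g u).

Lemma kernel_submodule : submodule act [set u | g u = 0].
Proof.
split=> [|a u v /= gu gv|x u /= gu].
- by rewrite /= (lin0 g_lin).
- by rewrite g_lin gu gv scaler0 addr0.
- by rewrite g_act gu (lin0 (actW_lin x)).
Qed.

Hypothesis gG : forall u, G u -> g u = 0.

Definition quo_lift (z : quo act G) : W := g (quo_repr z).

Lemma quo_lift_pi u : quo_lift (quo_pi act G u) = g u.
Proof.
have /quo_piP uP := quo_reprK (quo_pi act G u).
have := uP [set u | g u = 0]; rewrite /= (linB g_lin) => /(_ _)/subr0_eq; apply.
by split; [exact: kernel_submodule|exact: gG].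
Qed.

Lemma quo_lift_linear : linear quo_lift.
Proof.
move=> a y z; rewrite -[y]quo_reprK -[z]quo_reprK.
rewrite -[a *: _]/(quo_scale a _) -quo_piZ -quo_piD !quo_lift_pi.
exact: g_lin.
Qed.

Lemma quo_lift_act x z : quo_lift (quo_act x z) = actW x (quo_lift z).
Proof. by rewrite quo_lift_pi g_act. Qed.

End QuotientLift.

Section QuotientAction.
Variables (C : nzRingType) (X : Type) (V : lmodType C).
Variables (act : X -> V -> V) (G : set V).
Hypotheses (act_lin : forall x, linear (act x)).

Lemma quo_pi_linear : linear (quo_pi act G).
Proof. by move=> a u v; rewrite quo_piD quo_piZ. Qed.

Lemma quo_act_linear x : linear (quo_act (act := act) (G := G) x).
Proof.
move=> a y z; rewrite -[y]quo_reprK -[z]quo_reprK.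
rewrite -[a *: _]/(quo_scale a _) -quo_piZ -quo_piD !(quo_act_pi _ _ (act_lin x)).
by rewrite act_lin quo_piD quo_piZ.
Qed.

End QuotientAction.

Section HighestWeight.
Variables (C : numClosedFieldType) (cL cLA h hA : C).

Local Notation verma := (verma cL cLA h hA).
Local Notation vact := (@verma_act C cL cLA h hA).

Lemma word_act_linear x : linear (@word_act C x).
Proof. exact: lin_ext_linear. Qed.

Lemma word_act_word x w : word_act x (word C w) = word C (x :: w).
Proof. by rewrite /word_act lin_extU scale1r. Qed.

Lemma vact_linear x : linear (vact x).
Proof. exact/quo_act_linear/word_act_linear. Qed.

Definition vword (w : seq gen) : verma := quo_pi _ _ (word C w).

Lemma vact_word x w : vact x (vword w) = vword (x :: w).
Proof.
by rewrite /verma_act /vword (quo_act_pi _ _ (word_act_linear x)) word_act_word.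
Qed.

Lemma verma_ind (P : verma -> Prop) :
  P 0 -> (forall a u v, P u -> P v -> P (a *: u + v)) ->
  (forall w, P (vword w)) -> forall u, P u.
Proof.
move=> P0 PD Pw u; rewrite -[u]quo_reprK; move: (quo_repr u) => {}u.
elim/malg_ind: u => [|a u v Pu Pv|w]; last exact: Pw.
  by rewrite (lin0 (@quo_pi_linear _ _ _ _ _)).
by rewrite quo_piD quo_piZ; apply: PD.
Qed.

Lemma relator_vanish u : verma_relator cL cLA h hA u ->
  quo_pi (@word_act C) (verma_relator cL cLA h hA) u = 0.
Proof.
move=> Ru; rewrite -(lin0 (@quo_pi_linear _ _ _ _ _)); apply/quo_piP.
by rewrite subr0 => N [_ RN]; apply: RN.
Qed.

Lemma vword_bracket x y w : vword (x :: y :: w) =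
  swap_sign C x y *: vword (y :: x :: w)
  + \sum_(t <- sh_bracket C x y) t.1 *: vword (t.2 :: w).
Proof.
have := relator_vanish (Bracket_relator cL cLA h hA x y w).
have pi_lin := @quo_pi_linear C gen (words C) (@word_act C) (verma_relator cL cLA h hA).
rewrite !(linB pi_lin) (linZ pi_lin) (lin_sum pi_lin) => /subr0_eq/eqP.
rewrite subr_eq addrC /vword => /eqP ->; congr (_ + _).
by apply: eq_bigr => t _; rewrite (linZ pi_lin).
Qed.

Lemma vword_positive x : positive_gen x -> vword [:: x] = 0.
Proof. by move=> x_pos; apply/relator_vanish/Positive_relator. Qed.

Let scalar_relator w w' (a : C) :
  verma_relator cL cLA h hA (word C w - a *: word C w') -> vword w = a *: vword w'.
Proof.
move=> /relator_vanish.
have pi_lin := @quo_pi_linear C gen (words C) (@word_act C) (verma_relator cL cLA h hA).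
by rewrite (linB pi_lin) (linZ pi_lin) => /subr0_eq.
Qed.

Lemma vword_L0 : vword [:: gL 0] = h *: vword [::].
Proof. exact/scalar_relator/L0_relator. Qed.

Definition cartan_scalar (x : gen) : C :=
  match x with
  | gL _ => h | gAlpha _ => hA | gCL => cL | gCLAlpha => cLA | _ => 0
  end.

Lemma vword_cartan x : gen_degree x = 0 -> vword [:: x] = cartan_scalar x *: vword [::].
Proof.
case: x => [n|n|n|n| | |] /= n0.
- by rewrite (_ : n = 0); [exact/scalar_relator/L0_relator|lia].
- by rewrite (_ : n = 0); [exact/scalar_relator/Alpha0_relator|lia].
- by exfalso; lia.
- by exfalso; lia.
- exact/scalar_relator/CL_relator.
- exact/scalar_relator/CAlpha_relator.
- exact/scalar_relator/CLAlpha_relator.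
Qed.

Definition creation (x : gen) : bool := 0 < gen_degree x.

(** The easy half of the Poincare-Birkhoff-Witt theorem is that this span is the
    whole Verma module. *)
Inductive creation_span : verma -> Prop :=
| Span_word w of all creation w : creation_span (vword w)
| Span_zero : creation_span 0
| Span_lin a u v of creation_span u & creation_span v : creation_span (a *: u + v).

Lemma spanZ a u : creation_span u -> creation_span (a *: u).
Proof. by move=> Su; rewrite -[_ *: _]addr0; apply: Span_lin => //; apply: Span_zero. Qed.

Lemma spanD u v : creation_span u -> creation_span v -> creation_span (u + v).
Proof. by move=> Su Sv; rewrite -[u]scale1r; apply: Span_lin. Qed.

Lemma span_act x u : (forall w, all creation w -> creation_span (vword (x :: w))) ->
  creation_span u -> creation_span (vact x u).
Proof.
move=> xS; elim=> [w w_cr||a u1 u2 _ S1 _ S2]; first by rewrite vact_word; apply: xS.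
  by rewrite (lin0 (vact_linear x)); apply: Span_zero.
by rewrite vact_linear; apply: Span_lin.
Qed.

(** A generator that creates nothing is moved to the right, towards the highest
    weight vector; the brackets met on the way act on shorter words. *)
Lemma span_cons x w : all creation w -> creation_span (vword (x :: w)).
Proof.
elim: w x => [|y w IHw] x.
  move=> _; have [x_cr|x_nc] := boolP (creation x).
    by apply: Span_word; rewrite /= x_cr.
  have [x_pos|x_np] := boolP (positive_gen x).
    by rewrite vword_positive //; apply: Span_zero.
  rewrite vword_cartan; first exact/spanZ/Span_word.
  by move: x_nc x_np; rewrite positive_genE /creation; lia.
move=> /= /andP[y_cr w_cr]; have [x_cr|_] := boolP (creation x).
  by apply: Span_word; rewrite /= x_cr y_cr.
rewrite vword_bracket; apply: spanD.
  apply: spanZ; rewrite -vact_word; apply: span_act; last exact: IHw.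
  by move=> w' w'_cr; apply: Span_word; rewrite /= y_cr.
elim: (sh_bracket C x y) => [|t b IHb]; first by rewrite big_nil; apply: Span_zero.
by rewrite big_cons; apply: spanD => //; apply/spanZ/IHw.
Qed.

Lemma verma_span u : creation_span u.
Proof.
elim/verma_ind: u => [|a u v|w]; [exact: Span_zero|exact: Span_lin|].
elim: w => [|x w IHw]; first exact: Span_word.
by rewrite -vact_word; apply: span_act IHw => w'; apply: span_cons.
Qed.

Lemma L0_bracket y w : creation y ->
  swap_sign C (gL 0) y = 1 /\
  \sum_(t <- sh_bracket C (gL 0) y) t.1 *: vword (t.2 :: w) =
    ((gen_degree y)%:~R / 2) *: vword (y :: w).
Proof.
have sum1 a x : \sum_(t <- [:: (a, x)]) t.1 *: vword (t.2 :: w) = a *: vword (x :: w).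
  by rewrite big_seq1.
have sum2 a x b z : \sum_(t <- [:: (a, x); (b, z)]) t.1 *: vword (t.2 :: w) =
    a *: vword (x :: w) + b *: vword (z :: w).
  by rewrite big_cons big_seq1.
rewrite /creation /swap_sign; case: y => [n|n|n|n| | |] // n0; rewrite expr0; split=> //;
  rewrite /sh_bracket /listed_bracket.
- rewrite sum2 (_ : (0 + n == 0) = false); last by move: n0 => /=; lia.
  by rewrite mulr0n mul0r scale0r addr0 !add0r; congr (_ *: _); rewrite /gen_degree; field.
- rewrite sum2 (_ : (0 + n == 0) = false); last by move: n0 => /=; lia.
  by rewrite mulr0n mul0r oppr0 scale0r addr0 !add0r; congr (_ *: _); rewrite /gen_degree; field.
- by rewrite sum1 !add0r; congr (_ *: _); rewrite /gen_degree; field.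
- rewrite big_map big_seq1 /swap_sign; cbn [fst snd]; rewrite expr0 !addr0 mul1r.
  by congr (_ *: _); rewrite /gen_degree; field.
Qed.

Definition word_weight (w : seq gen) : int := \sum_(x <- w) gen_degree x.

Lemma L0_word w : all creation w ->
  vact (gL 0) (vword w) = (h + (word_weight w)%:~R / 2) *: vword w.
Proof.
rewrite vact_word; elim: w => [_|y w IHw /= /andP[y_cr w_cr]].
  by rewrite vword_L0 /word_weight big_nil mul0r addr0.
have [s1 bE] := L0_bracket w y_cr.
rewrite vword_bracket s1 bE scale1r -vact_word IHw // (linZ (vact_linear y)) vact_word.
rewrite -scalerDl /word_weight big_cons; congr (_ *: _).
by rewrite rmorphD /=; field.
Qed.

Lemma word_weight_gt0 x w : all creation (x :: w) -> 0 < word_weight (x :: w).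
Proof.
rewrite /word_weight; elim: w x => [|y w IHw] x /=.
  by rewrite andbT big_seq1.
move=> /andP[x_cr yw_cr]; rewrite big_cons; apply: addr_gt0 => //.
exact: IHw.
Qed.

End HighestWeight.

Section WeightProjection.
Variables (C : numClosedFieldType) (cL cLA h hA : C).

Local Notation verma := (verma cL cLA h hA).
Local Notation vact := (@verma_act C cL cLA h hA).
Local Notation hwv := (@vword C cL cLA h hA [::]).

Definition shifts (V : lmodType C) (L0 : V -> V) (s : seq C) (u : V) : V :=
  foldr (fun k w => L0 w - (h + k) *: w) u s.

Section Shifts.
Variables (V : lmodType C) (L0 : V -> V).
Hypothesis L0_lin : linear L0.

Lemma shifts_linear s : linear (shifts L0 s).
Proof.
elim: s => [|k s IHs] a u w //=; rewrite IHs L0_lin !scalerDr !scalerA.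
by rewrite [(h + k) * a]mulrC opprD addrACA scalerN scalerA.
Qed.

Lemma shifts_cat s t u : shifts L0 (s ++ t) u = shifts L0 s (shifts L0 t u).
Proof. exact: foldr_cat. Qed.

Lemma shiftsC s t u : shifts L0 (s ++ t) u = shifts L0 (t ++ s) u.
Proof.
have L0s r w : L0 (shifts L0 r w) = shifts L0 r (L0 w).
  by elim: r w => //= k r IHr w; rewrite (linB L0_lin) (linZ L0_lin) !IHr.
elim: s u => [|k s IHs] u; first by rewrite cats0.
rewrite cat_cons /= IHs !shifts_cat /= (linB (shifts_linear t)) (linZ (shifts_linear t)).
by rewrite L0s.
Qed.

Lemma shifts_hw s u : L0 u = h *: u -> shifts L0 s u = (\prod_(k <- s) - k) *: u.
Proof.
move=> Lu; elim: s => [|k s IHs] /=; first by rewrite big_nil scale1r.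
rewrite IHs (linZ L0_lin) Lu big_cons !scalerA -scalerBl; congr (_ *: _).
ring.
Qed.

End Shifts.

(** Some product of operators [L(0) - (h + k)] with [k <> 0] sends a given
    vector to the line of the highest weight vector, on which it is nonzero:
    this replaces the projection onto the top weight space. *)
Lemma weight_projection (u : verma) : exists2 s : seq C, all (fun k => k != 0) s &
  exists a, shifts (vact (gL 0)) s u = a *: hwv.
Proof.
have L0_lin := @vact_linear C cL cLA h hA (gL 0).
have Lhw : vact (gL 0) hwv = h *: hwv by rewrite vact_word vword_L0.
elim: (verma_span u) => [w w_cr||a u1 u2 _ [s1 s1P [a1 E1]] _ [s2 s2P [a2 E2]]].
- case: w w_cr => [|x w] w_cr; first by exists [::]; [|exists 1; rewrite scale1r].
  exists [:: (word_weight (x :: w))%:~R / 2].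
    rewrite /= andbT mulf_neq0 ?invr_eq0 ?pnatr_eq0 // intr_eq0.
    by rewrite gt_eqF // word_weight_gt0.
  by exists 0; rewrite /= L0_word // subrr scale0r.
- by exists [::] => //; exists 0; rewrite scale0r.
exists (s1 ++ s2); first by rewrite all_cat s1P.
exists (a * (\prod_(k <- s2) - k) * a1 + (\prod_(k <- s1) - k) * a2).
rewrite (shifts_linear L0_lin) (shiftsC L0_lin s1 s2 u1) !shifts_cat E1 E2.
rewrite !(linZ (shifts_linear L0_lin _)) !(shifts_hw L0_lin _ Lhw) !scalerA -scalerDl.
by congr (_ *: _); ring.
Qed.

Lemma submodule_hw_full (N : set verma) : submodule vact N -> N hwv -> N = setT.
Proof.
move=> [N0 ND Nact] Nhw; apply/seteqP; split=> // u _.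
elim/verma_ind: u => //; elim=> [//|x w IHw].
by rewrite -vact_word; apply: Nact.
Qed.

End WeightProjection.

Section SimpleQuotient.
Variables (C : numClosedFieldType) (cL cLA h hA : C).
Variables (W : lmodType C) (act : gen -> W -> W) (v : W).

Hypothesis act_lin : forall x, linear (act x).
Hypothesis act_bracket : forall x y u,
  act x (act y u) - swap_sign C x y *: act y (act x u)
  = \sum_(t <- sh_bracket C x y) t.1 *: act t.2 u.
Hypothesis act_CL : forall u, act gCL u = cL *: u.
Hypothesis act_CAlpha : forall u, act gCAlpha u = 0.
Hypothesis act_CLAlpha : forall u, act gCLAlpha u = cLA *: u.
Hypothesis v_positive : forall x, positive_gen x -> act x v = 0.
Hypothesis v_L0 : act (gL 0) v = h *: v.
Hypothesis v_Alpha0 : act (gAlpha 0) v = hA *: v.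
Hypothesis v_neq0 : v <> 0.
Hypothesis v_cyclic : forall u, u <> 0 -> cyclic_submodule act u v.

Local Notation verma := (verma cL cLA h hA).
Local Notation vact := (@verma_act C cL cLA h hA).
Local Notation hwv := (@vword C cL cLA h hA [::]).

Definition word_eval (u : words C) : W := lin_ext (fun w => foldr act v w) u.

Lemma word_eval_linear : linear word_eval.
Proof. exact: lin_ext_linear. Qed.

Lemma word_eval_word w : word_eval (word C w) = foldr act v w.
Proof. by rewrite /word_eval lin_extU scale1r. Qed.

Lemma word_eval_act x u : word_eval (word_act x u) = act x (word_eval u).
Proof.
have ev := word_eval_linear; have wl := @word_act_linear C x.
elim/malg_ind: u => [|a u1 u2 E1 E2|w].
- by rewrite (lin0 wl) (lin0 ev) (lin0 (act_lin x)).
- by rewrite wl !ev act_lin E1 E2.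
- by rewrite word_act_word !word_eval_word.
Qed.

Lemma word_eval_relator u : verma_relator cL cLA h hA u -> word_eval u = 0.
Proof.
have ev := word_eval_linear.
case=> [x y w|x x_pos|||w|w|w].
- rewrite !(linB ev) (linZ ev) (lin_sum ev) !word_eval_word /= act_bracket.
  apply/eqP; rewrite subr_eq0; apply/eqP; apply: eq_bigr => t _.
  by rewrite (linZ ev) word_eval_word.
- by rewrite word_eval_word /= v_positive.
- by rewrite (linB ev) (linZ ev) !word_eval_word /= v_L0 subrr.
- by rewrite (linB ev) (linZ ev) !word_eval_word /= v_Alpha0 subrr.
- by rewrite (linB ev) (linZ ev) !word_eval_word /= act_CL subrr.
- by rewrite (linB ev) (linZ ev) !word_eval_word /= act_CAlpha scale0r subrr.
- by rewrite (linB ev) (linZ ev) !word_eval_word /= act_CLAlpha subrr.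
Qed.

Definition verma_eval : verma -> W :=
  quo_lift (act := @word_act C) (G := verma_relator cL cLA h hA) word_eval.

Lemma verma_eval_linear : linear verma_eval.
Proof. exact: (quo_lift_linear act_lin word_eval_linear word_eval_act word_eval_relator). Qed.

Lemma verma_eval_act x u : verma_eval (vact x u) = act x (verma_eval u).
Proof. exact: (quo_lift_act act_lin word_eval_linear word_eval_act word_eval_relator). Qed.

Lemma verma_eval_word w : verma_eval (vword _ _ _ _ w) = foldr act v w.
Proof.
rewrite /verma_eval /vword.
rewrite (quo_lift_pi act_lin word_eval_linear word_eval_act word_eval_relator).
exact: word_eval_word.
Qed.

Let kernel : set verma := [set u | verma_eval u = 0].

Lemma kernel_proper : proper_submodules vact kernel.
Proof.
split; first exact: (kernel_submodule act_lin verma_eval_linear verma_eval_act).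
move=> kT; apply: v_neq0; have : kernel hwv by rewrite kT.
by rewrite /kernel /= verma_eval_word.
Qed.

Lemma shifts_eval s u : verma_eval (shifts h (vact (gL 0)) s u) =
  shifts h (act (gL 0)) s (verma_eval u).
Proof.
elim: s => //= k s IHs; rewrite (linB verma_eval_linear) (linZ verma_eval_linear).
by rewrite verma_eval_act IHs.
Qed.

(** Otherwise [N] contains a vector mapped to [v], since the image of [u]
    generates a submodule containing [v]; its component in the line of the highest weight vector is
    nonzero and is obtained by acting with [L(0)]. *)
Lemma proper_sub_kernel N u : proper_submodules vact N -> N u -> verma_eval u = 0.
Proof.
move=> [Nsub NT] Nu; apply: contrapT => u0; apply: NT.
have [N0 ND Nact] := Nsub.
have [u' Nu' u'v] : exists2 u', N u' & verma_eval u' = v.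
  have /(_ [set w | exists2 u', N u' & verma_eval u' = w]) := v_cyclic u0.
  apply; split; last by move=> _ ->; exists u.
  split=> [|a _ _ [w1 N1 <-] [w2 N2 <-]|x _ [w Nw <-]].
  - by exists 0 => //; apply: (lin0 verma_eval_linear).
  - by exists (a *: w1 + w2); [apply: ND|apply: verma_eval_linear].
  - by exists (vact x w); [apply: Nact|apply: verma_eval_act].
have [s s0 [a su']] := weight_projection u'.
apply: submodule_hw_full => //; have Nsu : N (shifts h (vact (gL 0)) s u').
  elim: s {s0 su'} => //= k s IHs; rewrite -scaleNr addrC; apply: ND => //.
  exact: Nact.
have a0 : a != 0.
  apply/eqP => a0; apply: v_neq0.
  have /(congr1 verma_eval) := su'; rewrite a0 scale0r (lin0 verma_eval_linear).
  rewrite shifts_eval u'v (shifts_hw (act_lin _) _ v_L0) => E.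
  have p0 : \prod_(k <- s) - k != 0 :> C.
    by rewrite prodf_seq_neq0; apply: sub_all s0 => k; rewrite oppr_eq0.
  by rewrite -[v]scale1r -(mulVf p0) -scalerA E scaler0.
rewrite su' in Nsu; rewrite -[hwv]scale1r -(mulVf a0) -scalerA -[_ *: _]addr0.
exact: ND.
Qed.

(** The kernel of the map from the Verma module is its largest proper submodule,
    so the simple quotient is the image, which [v] generates. *)
Lemma irr_iso_cyclic : isomorphic_to_submodule
  (@irr_act C cL cLA h hA) act (cyclic_submodule act v).
Proof.
pose G := \bigcup_(N in proper_submodules vact) N.
have GK u : G u -> verma_eval u = 0 by move=> [N NP Nu]; apply: proper_sub_kernel NP Nu.
pose f : irr cL cLA h hA -> W := quo_lift (act := vact) (G := G) verma_eval.
have f_lin : linear f.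
  exact: (quo_lift_linear act_lin verma_eval_linear verma_eval_act GK).
have f_pi u : f (quo_pi vact G u) = verma_eval u.
  exact: (quo_lift_pi act_lin verma_eval_linear verma_eval_act GK).
have f_act x u : f (irr_act x u) = act x (f u).
  exact: (quo_lift_act act_lin verma_eval_linear verma_eval_act GK).
pose F : {linear irr cL cLA h hA -> W} := HB.pack f (GRing.isLinear.Build _ _ _ _ f f_lin).
exists F; split.
- move=> y z fyz; apply/eqP; rewrite -subr_eq0; apply/eqP.
  have : f (y - z) = 0 by rewrite (linB f_lin) [f y]fyz subrr.
  move: (y - z) => u; rewrite -[u]quo_reprK f_pi => u0.
  rewrite -(lin0 (@quo_pi_linear _ _ _ vact G)); apply/quo_piP; rewrite subr0 => N [_ GN].
  by apply: GN; exists kernel; first exact: kernel_proper.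
- exact: f_act.
apply/seteqP; split=> [_ [y _ <-]|w]; last first.
  move/(_ (range f)); apply; split; last first.
    by move=> _ ->; exists (quo_pi vact G hwv); rewrite ?f_pi ?verma_eval_word.
  split=> [|a _ _ [y _ <-] [z _ <-]|x _ [y _ <-]].
  - by exists 0 => //; apply: (lin0 f_lin).
  - by exists (a *: y + z) => //; apply: f_lin.
  - by exists (irr_act x y) => //; apply: f_act.
move=> N [[N0 ND Nact] Nv]; rewrite -[y]quo_reprK [F _]f_pi.
elim/verma_ind: (quo_repr y) => [|a u1 u2 N1 N2|s].
- by rewrite (lin0 verma_eval_linear).
- by rewrite verma_eval_linear; apply: ND.
- by rewrite verma_eval_word; elim: s => [|x s IHs] /=; [apply: Nv|apply: Nact].
Qed.

End SimpleQuotient.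

(** * The modules F_(p,r) *)

Section FockModules.
Variables (C : numClosedFieldType) (cL cLA p r : C).

Local Notation gamma := (gamma_pr cL p r).
Local Notation act := (F_pr_act cL cLA p r).
Local Notation v := (fock_vac C).

Lemma c_zero_pr : heis_form (heis_c C) gamma = - (p + 1).
Proof. by rewrite /heis_form /gamma_pr /= /GRing.scale /=; field. Qed.

Lemma d_zero_pr : heis_form (heis_d C) gamma = (p + 1) * ((cL - 3) / 12) + 2 * r.
Proof. by rewrite /heis_form /gamma_pr /= /GRing.scale /=; field. Qed.

Lemma vac_L0 : act (gL 0) v = h_pr cL p r *: v.
Proof.
apply: etrans (omega_vac cL gamma) _; rewrite c_zero_pr d_zero_pr /h_pr.
by congr (_ *: _); field.
Qed.

Lemma vac_Alpha0 : act (gAlpha 0) v = ((1 + p) * cLA) *: v.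
Proof.
apply: etrans (congr1 _ (c_zero gamma v)) _; rewrite scalerA c_zero_pr.
by congr (_ *: _); ring.
Qed.

Lemma vac_positive x : positive_gen x -> act x v = 0.
Proof.
rewrite positive_genE => x_neg.
exact: degree_vac (@fock_act_degree C cL cLA gamma x) x_neg.
Qed.

Lemma vac_neq0 : v <> 0.
Proof. by move/eqP; rewrite monalgU_eq0 oner_eq0. Qed.

End FockModules.

Theorem proposition3p5 (R : realType) (cL cLA : R[i]) (hcLA : cLA != 0)
    (p : int) (hp : p < 0) (r : R[i]) :
  (forall x : fock R[i], x != 0 ->
     cyclic_submodule (F_pr_act cL cLA p%:~R r) x (fock_vac R[i])) /\
  isomorphic_to_submodule (@irr_pr_act R[i] cL cLA p%:~R r)
    (F_pr_act cL cLA p%:~R r)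
    (cyclic_submodule (F_pr_act cL cLA p%:~R r) (fock_vac R[i])).
Proof.
have socle (x : fock R[i]) : x != 0 ->
    cyclic_submodule (F_pr_act cL cLA p%:~R r) x (fock_vac R[i]).
  apply: cyclic_vac hcLA _ x => n; rewrite c_zero_pr.
  have -> : - (p%:~R + 1) + n.+2%:R = (n.+1%:Z - p)%:~R :> R[i] by ring.
  by rewrite intr_eq0; lia.
split; first exact: socle.
apply: (@irr_iso_cyclic R[i] cL cLA (h_pr cL p%:~R r) ((1 + p%:~R) * cLA) (fock R[i])).
- exact: fock_act_linear.
- exact: fock_brackets.
- by [].
- by [].
- by [].
- exact: vac_positive.
- exact: vac_L0.
- exact: vac_Alpha0.
- exact: vac_neq0.
- by move=> u /eqP; apply: socle.
Qed.
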